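(* Under the setting below, the stochastic game among the $N$ prosumers with payoffs $V_i$ admits a stationary Nash equilibrium: there is a profile of stationary policies $\boldsymbol{\Psi}^*=(\Psi_1^*,\dots,\Psi_N^* )$ such that for every $i\in\{1,\dots,N\}$ and every (possibly history-dependent, randomized) policy $\theta_i$ of prosumer $i$, $$V_i(\Psi_i^*,\boldsymbol{\Psi}^*_{-i})\ \ge\ V_i(\theta_i,\boldsymbol{\Psi}^*_{-i}).$$
   Context: There are $N$ prosumers. Prosumer $i$ has state set $\mathcal{S}_i=\{0,\dots,S_i^{\max}\}$, action set $\mathcal{A}_i=\mathcal{L}_i\times\mathcal{D}_i$ with $\mathcal{L}_i=\{0,\dots,L_i^{\max}\}$, $\mathcal{D}_i=\{0,\dots,D_i^{\max}\}$, and state dynamics $S_i(t+1)=\min\{[S_i(t)+G_i(t)+D_i(t)-L_i(t)]^+,S_i^{\max}\}$ where $A_i(t)=(L_i(t),D_i(t))$, $[x]^+=\max\{0,x\}$, and in state $s$ only actions $(l,d)$ with $0\le s+d-l\le S_i^{\max}$ are taken. The processes $(G_i(t))_{t\ge1}$, $i=1,\dots,N$, are mutually independent, each i.i.d. and $\mathbb{Z}$-valued with law $G_i$, and $\lambda_i:=\min_{|k|\le S_i^{\max}}\mathbb{P}\{G_i=k\}>0$ for all $i$. Each prosumer's state evolves only according to its own actions and generated energy, so under a profile of policies the state-action processes of different prosumers are independent. A policy of prosumer $i$ is a sequence of (possibly history-dependent) probability distributions over $\mathcal{A}_i$ used to draw $A_i(t)$; a policy is stationary if the action is drawn from a distribution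 $\Psi_i(\cdot\mid S_i(t))$ depending only on the current state. For a profile $\boldsymbol{a}=(a_1,\dots,a_N)$ of actions, $U_i(\boldsymbol{a})\in\mathbb{R}$ is prosumer $i$'s instantaneous payoff (in the paper $U_i(\boldsymbol a)=f_i(l_i)-d_i\,p_i(d_1,\dots,d_N)$ with $f_i$ increasing and $p_i$ a price function; any real function of $\boldsymbol a$ is allowed). Each prosumer has a continuous weighting function $w_i:[0,1]\to\mathbb{R}$ and a valuation function $v_i:\mathbb{R}\to\mathbb{R}$ (prospect theory). Writing $\mathbb{P}_t^{\theta}(s,a):=\mathbb{P}^{\theta}\{S(t)=s,A(t)=a\}$ for the joint state-action law of a prosumer at time $t$ under its policy $\theta$, the (prospect) payoff of prosumer $i$ when it uses policy $\theta_i$ and the others use stationary policies $\boldsymbol{\Psi}_{-i}$ is $$V_i(\theta_i,\boldsymbol{\Psi}_{-i})=\limsup_{T\to\infty}\frac1T\sum_{t=1}^T\sum_{(\boldsymbol{s},\boldsymbol{a})}\mathbb{P}^{\theta_i}_t(s_i,a_i)\,w_i\Big(\prod_{j\ne i}\mathbb{P}^{\Psi_j}_t(s_j,a_j)\Big)\,v_i\big(U_i(\boldsymbol a)\big),$$ the sum ranging over all joint states $\boldsymbol s\in\prod_j\mathcal{S}_j$ and joint actions $\boldsymbol a\in\prod_j\mathcal{A}_j$. *)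

(* Defs.v *)
From Stdlib Require Import Reals ZArith Arith List ClassicalEpsilon.
Import ListNotations.
Open Scope R_scope.

Definition rsum {A : Type} (f : A -> R) (l : list A) : R :=
  fold_right (fun x acc => f x + acc) 0 l.
Definition rprod {A : Type} (f : A -> R) (l : list A) : R :=
  fold_right (fun x acc => f x * acc) 1 l.

(* value of a convergent real series (junk 0-chosen value otherwise) *)
Definition series_value (u : nat -> R) : R :=
  epsilon (inhabits 0) (fun l => infinite_sum u l).

Definition zsum (f : Z -> R) : R :=
  series_value (fun n => f (Z.of_nat n)) +
  series_value (fun n => f (- Z.of_nat n - 1)%Z).

Definition is_limsup (u : nat -> R) (l : R) : Prop :=
  (forall eps, 0 < eps -> exists N, forall n, (N <= n)%nat -> u n < l + eps) /\
  (forall eps, 0 < eps -> forall N, exists n, (N <= n)%nat /\ l - eps < u n).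
Definition limsup (u : nat -> R) : R := epsilon (inhabits 0) (is_limsup u).

Definition is_Z_law (pG : Z -> R) : Prop :=
  (forall k, 0 <= pG k) /\
  exists a b, infinite_sum (fun n => pG (Z.of_nat n)) a /\
              infinite_sum (fun n => pG (- Z.of_nat n - 1)%Z) b /\ a + b = 1.

Definition lambda_pos (Smax : nat) (pG : Z -> R) : Prop :=
  forall k : Z, (Z.abs k <= Z.of_nat Smax)%Z -> 0 < pG k.

Definition cont_on_01 (f : R -> R) : Prop :=
  forall x, 0 <= x <= 1 -> limit1_in f (fun y => 0 <= y <= 1) (f x) x.

Definition action := (nat * nat)%type.          (* (l, d) *)
Definition hist := list (nat * action).         (* own past (state, action) pairs,
                                                   most recent first *)

Definition states (Smax : nat) : list nat := seq 0 (S Smax).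
Definition actions (Lmax Dmax : nat) : list action :=
  list_prod (seq 0 (S Lmax)) (seq 0 (S Dmax)).
Definition pairs (Smax Lmax Dmax : nat) : list (nat * action) :=
  list_prod (states Smax) (actions Lmax Dmax).

Definition pre_state (s : nat) (a : action) : Z :=
  (Z.of_nat s + Z.of_nat (snd a) - Z.of_nat (fst a))%Z.

Definition admissible (Smax s : nat) (a : action) : Prop :=
  (0 <= pre_state s a <= Z.of_nat Smax)%Z.

Definition clamp (Smax : nat) (x : Z) : Z := Z.min (Z.max 0 x) (Z.of_nat Smax).

Definition kernel (Smax : nat) (pG : Z -> R) (s : nat) (a : action) (s' : nat) : R :=
  zsum (fun g => if Z.eqb (clamp Smax (pre_state s a + g)) (Z.of_nat s')
                 then pG g else 0).

Definition dist_at (Smax Lmax Dmax s : nat) (q : action -> R) : Prop :=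
  (forall a, In a (actions Lmax Dmax) -> 0 <= q a) /\
  rsum q (actions Lmax Dmax) = 1 /\
  (forall a, In a (actions Lmax Dmax) -> ~ admissible Smax s a -> q a = 0).

(* general (history-dependent, randomized) policy:
   theta h s a = prob. of action a given own past history h and current state s *)
Definition policy := hist -> nat -> action -> R.
Definition valid_policy (Smax Lmax Dmax : nat) (th : policy) : Prop :=
  forall h s, (s <= Smax)%nat -> dist_at Smax Lmax Dmax s (th h s).

Definition spolicy := nat -> action -> R.
Definition valid_spolicy (Smax Lmax Dmax : nat) (Ps : spolicy) : Prop :=
  forall s, (s <= Smax)%nat -> dist_at Smax Lmax Dmax s (Ps s).
Definition of_stat (Ps : spolicy) : policy := fun _ s => Ps s.

Definition valid_init (Smax : nat) (mu : nat -> R) : Prop :=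
  (forall s, (s <= Smax)%nat -> 0 <= mu s) /\ rsum mu (states Smax) = 1.

Fixpoint hprob (Smax : nat) (pG : Z -> R) (mu : nat -> R) (th : policy)
         (h : hist) : R :=
  match h with
  | [] => 1
  | (s, a) :: past =>
      (match past with
       | [] => mu s
       | (s0, a0) :: _ => kernel Smax pG s0 a0 s
       end) * th past s a * hprob Smax pG mu th past
  end.

Fixpoint hists (Smax Lmax Dmax : nat) (n : nat) : list hist :=
  match n with
  | O => [ [] ]
  | S m => flat_map (fun h => map (fun p => p :: h) (pairs Smax Lmax Dmax))
                    (hists Smax Lmax Dmax m)
  end.

(* P_t^theta(s, a) with t = n + 1 *)
Definition marg (Smax Lmax Dmax : nat) (pG : Z -> R) (mu : nat -> R) (th : policy)
           (n s : nat) (a : action) : R :=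
  rsum (fun h => hprob Smax pG mu th ((s, a) :: h)) (hists Smax Lmax Dmax n).

Record game := mkGame {
  nP   : nat;                       (* N; prosumers indexed 0 .. N-1 *)
  Smax : nat -> nat;
  Lmax : nat -> nat;
  Dmax : nat -> nat;
  lawG : nat -> Z -> R;
  init : nat -> nat -> R;
  wf   : nat -> R -> R;
  vf   : nat -> R -> R;
  U    : nat -> list action -> R    (* U_i(a_0, ..., a_{N-1}) *)
}.

Definition pairs_of (G : game) (j : nat) := pairs (Smax G j) (Lmax G j) (Dmax G j).

Fixpoint profs (G : game) (k : nat) : list (list (nat * action)) :=
  match k with
  | O => [ [] ]
  | S m => flat_map (fun p => map (fun x => p ++ [x]) (pairs_of G m)) (profs G m)
  end.

Definition margG (G : game) (j : nat) (th : policy) (n s : nat) (a : action) : R :=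
  marg (Smax G j) (Lmax G j) (Dmax G j) (lawG G j) (init G j) th n s a.

Definition dflt : nat * action := (0%nat, (0%nat, 0%nat)).

(* summand at time t = n + 1 *)
Definition stage (G : game) (i : nat) (th : policy) (Ps : nat -> spolicy) (n : nat) : R :=
  rsum (fun prof =>
          margG G i th n (fst (nth i prof dflt)) (snd (nth i prof dflt)) *
          wf G i (rprod (fun j => margG G j (of_stat (Ps j)) n
                                     (fst (nth j prof dflt)) (snd (nth j prof dflt)))
                        (filter (fun j => negb (Nat.eqb j i)) (seq 0 (nP G)))) *
          vf G i (U G i (map snd prof)))
       (profs G (nP G)).

Definition Vpay (G : game) (i : nat) (th : policy) (Ps : nat -> spolicy) : R :=
  limsup (fun T => / INR (S T) * rsum (stage G i th Ps) (seq 0 (S T))).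

(* Main.v *)
Require Import Defs.
From Stdlib Require Import Reals ZArith Arith List.
From Stdlib Require Import Lra Lia Bool FinFun FunctionalExtensionality ClassicalEpsilon.
Import ListNotations.
Open Scope R_scope.

(** Since every admissible transition has probability at least lambda, a
    stationary policy Psi has a relative value function h that is the unique
    solution of a discounted equation (kernel minus lambda), and the state law
    under Psi converges geometrically to its stationary law pi. Rather than
    solving for h and pi as functions of Psi, one Brouwer fixed point is taken
    in all the variables (Psi_j, pi_j, h_j) at once: h_j is updated by policy
    evaluation, pi_j by one transition step, and Psi_j by Nash's improvement
    map applied to the advantages; player j's reward is the limit of its stage
    reward against the product laws pi_k Psi_k of the others. At a fixed point
    h_i satisfies the Bellman inequality r + K h - h <= g, with equality on
    average over Psi_i. Telescoping along the state-action law of an arbitrary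
    policy bounds its average payoff by g, and Psi_i attains g.

    Brouwer's theorem is obtained from Kuhn's cubical lemma, itself proved by a
    mod 2 Stokes formula for the cup product of the coboundaries of the labels. *)

(** * Kuhn's cubical lemma *)

(** The weighting functions make payoffs nonlinear in the laws of the opponents, but [V_i] stays
    linear in player i's own state-action law. Against stationary opponents, whose laws converge,
    player i thus faces in the limit an ordinary average-reward decision problem; the error made by
    passing to the limit reward is bounded independently of player i's policy and disappears from
    averages. History dependence does no harm, because the one-step laws of any policy obey the same
    balance equation. Best responses need not be unique, so a best-response map would be set-valued;
    Nash's map is single-valued and continuous. Taking [pi] and [h] as unknowns of their own also
    avoids proving that they depend continuously on the policy. Subtracting lambda from every kernel
    entry leaves rows of mass [1 - |S| lambda], which gives an a priori bound on [h], hence a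
    compact box for Brouwer; the subtracted mass reappears as the optimal average payoff, the
    constant [g = lambda * sum h]. *)

Section KuhnLemma.

Local Open Scope nat_scope.

Fixpoint xsum (n : nat) (f : nat -> bool) : bool :=
  match n with O => false | S m => xorb (xsum m f) (f m) end.

Lemma xsum_ext n f g : (forall i, i < n -> f i = g i) -> xsum n f = xsum n g.
Proof.
  induction n as [|n IH]; intros H; simpl; trivial.
  rewrite (H n) by lia. rewrite IH; auto.
Qed.

Lemma xsum_xorb n f g :
  xsum n (fun i => xorb (f i) (g i)) = xorb (xsum n f) (xsum n g).
Proof.
  induction n as [|n IH]; simpl; trivial. rewrite IH.
  destruct (xsum n f), (xsum n g), (f n), (g n); reflexivity.
Qed.

Lemma xsum_false n f : (forall i, i < n -> f i = false) -> xsum n f = false.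
Proof.
  induction n as [|n IH]; intros H; simpl; trivial.
  rewrite (H n) by lia. rewrite IH; auto.
Qed.

Lemma xsum_andb b n f : xsum n (fun i => b && f i) = b && xsum n f.
Proof.
  induction n as [|n IH]; simpl; [now destruct b|]. rewrite IH.
  now destruct b.
Qed.

Lemma xsum_single n k f :
  k < n -> (forall i, i < n -> i <> k -> f i = false) -> xsum n f = f k.
Proof.
  induction n as [|n IH]; intros Hk H; [lia|]. simpl.
  destruct (Nat.eq_dec k n) as [->|Hn].
  - rewrite xsum_false; [now destruct (f n)|]. intros i Hi. apply H; lia.
  - rewrite (H n) by lia. rewrite IH; [now destruct (f k)|lia|].
    intros i Hi. apply H; lia.
Qed.

Lemma xsum_true_ex n f : xsum n f = true -> exists i, i < n /\ f i = true.
Proof.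
  induction n as [|n IH]; simpl; [discriminate|]. intros H.
  destruct (f n) eqn:E; [exists n; auto|].
  rewrite xorb_false_r in H. destruct (IH H) as (i & Hi & Hf). exists i; auto.
Qed.

Lemma xsum_telescope n f :
  xsum n (fun m => xorb (f (S m)) (f m)) = xorb (f n) (f 0).
Proof.
  induction n as [|n IH]; simpl; [now rewrite xorb_nilpotent|]. rewrite IH.
  destruct (f n), (f 0), (f (S n)); reflexivity.
Qed.

(** Off-diagonal terms come in equal pairs, which cancel modulo 2. *)
Lemma xsum_symmetric n (g : nat -> nat -> bool) :
  (forall j k, g j k = g k j) -> (forall j, g j j = false) ->
  xsum n (fun j => xsum n (g j)) = false.
Proof.
  intros Hs Hd. induction n as [|n IH]; simpl; trivial.
  rewrite xsum_xorb, IH, Hd, (xsum_ext n (fun j => g j n) (g n)); auto.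
  now destruct (xsum n (g n)).
Qed.

(** * Cubical cochains modulo 2 *)

Definition upd (x : nat -> nat) (i v : nat) : nat -> nat :=
  fun j => if j =? i then v else x j.
Definition shift (x : nat -> nat) (j : nat) : nat -> nat := upd x j (S (x j)).
Definition drop (A : nat -> bool) (j : nat) : nat -> bool :=
  fun i => A i && negb (i =? j).

Ltac upd_solve :=
  let i := fresh "i" in
  apply functional_extensionality; intros i; unfold shift, upd, drop;
  repeat match goal with
         | |- context [?a =? ?b] => destruct (Nat.eqb_spec a b); subst
         end; simpl; try lia; try congruence; auto.

Lemma upd_same x i v : upd x i v i = v.
Proof. unfold upd. now rewrite Nat.eqb_refl. Qed.

Lemma upd_other x i v j : j <> i -> upd x i v j = x j.
Proof. intros H. unfold upd. now destruct (Nat.eqb_spec j i). Qed.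

(* A mod 2 cochain assigns a bit to the cube with lowest vertex x spanned by
   the directions in A; the coboundary sums over the facets of the cube. *)
Definition cochain := (nat -> bool) -> (nat -> nat) -> bool.

Definition coboundary (d : nat) (c : cochain) : cochain := fun A x =>
  xsum d (fun j => A j && xorb (c (drop A j) (shift x j)) (c (drop A j) x)).

Lemma coboundary_coboundary d c A x :
  coboundary d (coboundary d c) A x = false.
Proof.
  (* The contribution of the ordered pair of directions (j, k): a second difference, symmetric in j
     and k and zero on the diagonal. *)
  set (g := fun j k => A j && (A k && negb (k =? j)) &&
    xorb (xorb (c (drop (drop A j) k) (shift (shift x j) k))
               (c (drop (drop A j) k) (shift x j)))
         (xorb (c (drop (drop A j) k) (shift x k))
               (c (drop (drop A j) k) x))).
  transitivity (xsum d (fun j => xsum d (g j))).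
  - apply xsum_ext. intros j _. unfold coboundary at 1 2.
    rewrite <- xsum_xorb, <- xsum_andb. apply xsum_ext. intros k _.
    unfold g. change (drop A j k) with (A k && negb (k =? j)).
    set (c1 := c _ (shift (shift _ _) _)). set (c2 := c _ (shift x j)).
    set (c3 := c _ (shift x k)). set (c4 := c _ x).
    destruct (A j), (A k), (k =? j), c1, c2, c3, c4; reflexivity.
  - apply xsum_symmetric.
    + intros j k. unfold g.
      replace (drop (drop A k) j) with (drop (drop A j) k)
        by (apply functional_extensionality; intros i; unfold drop; destruct (A i), (i =? j), (i =? k); reflexivity).
      replace (shift (shift x k) j) with (shift (shift x j) k) by upd_solve.
      rewrite (Nat.eqb_sym j k).
      set (c1 := c _ (shift (shift _ _) _)). set (c2 := c _ (shift x j)).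
      set (c3 := c _ (shift x k)). set (c4 := c _ x).
      destruct (A j), (A k), (k =? j), c1, c2, c3, c4; reflexivity.
    + intros j. unfold g. rewrite Nat.eqb_refl.
      now destruct (A j).
Qed.

(* Leibniz rule for the cup product with the 0-cochain [l]. *)
Lemma coboundary_mult d (l : (nat -> nat) -> bool) c A x :
  coboundary d (fun B y => l y && c B y) A x =
  xorb (xsum d (fun j => A j && (xorb (l (shift x j)) (l x) &&
                                 c (drop A j) (shift x j))))
       (l x && coboundary d c A x).
Proof.
  unfold coboundary. rewrite <- xsum_andb, <- xsum_xorb.
  apply xsum_ext. intros j _.
  set (c1 := c _ (shift _ _)). set (c2 := c _ x).
  destruct (A j), (l x), (l (shift x j)), c1, c2; reflexivity.
Qed.

(* As iterated coboundaries these cochains are closed, so by the Leibniz rule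
   they are the cup products of the coboundaries of the labels. *)
Fixpoint cup (d : nat) (l : nat -> (nat -> nat) -> bool) (k : nat) : cochain :=
  match k with
  | O => fun _ _ => true
  | S m => coboundary d (fun A x => l m x && cup d l m A x)
  end.

Lemma cup_closed d l k A x : coboundary d (cup d l k) A x = false.
Proof.
  destruct k; [|apply coboundary_coboundary].
  apply xsum_false. intros j _. simpl. apply andb_false_r.
Qed.

Definition in_cube (A : nat -> bool) (x y : nat -> nat) : Prop :=
  forall i, y i = x i \/ (A i = true /\ y i = S (x i)).

(** Since the lower product is closed, the Leibniz rule leaves only edge terms: some edge at [x]
    flips label [k - 1], and the product of the earlier labels is nonzero on the facet at the far
    end of that edge. Recursion into this facet finds the other flips. *)
Lemma cup_flip d l k A x :
  cup d l k A x = true ->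
  forall m, m < k ->
  exists y z, in_cube A x y /\ in_cube A x z /\ l m y = false /\ l m z = true.
Proof.
  revert A x. induction k as [|k IH]; intros A x H m Hm; [lia|].
  simpl in H. rewrite coboundary_mult, cup_closed, andb_false_r, xorb_false_r in H.
  apply xsum_true_ex in H. destruct H as (j & _ & H).
  apply andb_prop in H. destruct H as [HA H].
  apply andb_prop in H. destruct H as [Hl Hc].
  assert (Hx : in_cube A x x) by (intros i; auto).
  assert (Hs : in_cube A x (shift x j)).
  { intros i. unfold shift, upd. destruct (Nat.eqb_spec i j); subst; auto. }
  destruct (Nat.eq_dec m k) as [->|Hmk].
  - destruct (l k (shift x j)) eqn:E1, (l k x) eqn:E2; simpl in Hl; try discriminate.
    + exists x, (shift x j); auto.
    + exists (shift x j), x; auto.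
  - assert (Hsub : forall y, in_cube (drop A j) (shift x j) y -> in_cube A x y).
    { intros y Hy i. specialize (Hy i). unfold drop, shift, upd in Hy.
      destruct (Nat.eqb_spec i j) as [Hij|Hij]; simpl in Hy; [subst i|].
      - rewrite andb_false_r in Hy. destruct Hy as [Hy|[Hy _]]; [auto|discriminate].
      - rewrite andb_true_r in Hy. auto. }
    destruct (IH _ _ Hc m) as (y & z & Hy & Hz & Hl'); [lia|].
    exists y, z; auto.
Qed.

(** * Sums over the vertices of a box *)

Fixpoint box_sum (n k : nat) (F : (nat -> nat) -> bool) (x : nat -> nat) : bool :=
  match k with
  | O => F x
  | S m => xsum n (fun v => box_sum n m F (upd x m v))
  end.

Definition in_box (n k : nat) (x y : nat -> nat) : Prop :=
  (forall i, k <= i -> y i = x i) /\ (forall i, i < k -> y i < n).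

Lemma in_box_S n k x y v :
  v < n -> in_box n k (upd x k v) y -> in_box n (S k) x y.
Proof.
  intros Hv [H1 H2]. split; intros i Hi.
  - rewrite H1 by lia. apply upd_other. lia.
  - destruct (Nat.eq_dec i k) as [->|]; [|apply H2; lia].
    rewrite H1 by lia. now rewrite upd_same.
Qed.

Lemma box_sum_ext n k F F' x :
  (forall y, in_box n k x y -> F y = F' y) -> box_sum n k F x = box_sum n k F' x.
Proof.
  revert x. induction k as [|k IH]; intros x H; simpl.
  - apply H. split; auto; lia.
  - apply xsum_ext. intros v Hv. apply IH. intros y Hy. apply H.
    eapply in_box_S; eauto.
Qed.

Lemma box_sum_xsum n k d (F : nat -> (nat -> nat) -> bool) x :
  box_sum n k (fun y => xsum d (fun j => F j y)) x =
  xsum d (fun j => box_sum n k (F j) x).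
Proof.
  assert (Hswap : forall a b (g : nat -> nat -> bool),
    xsum a (fun i => xsum b (g i)) = xsum b (fun j => xsum a (fun i => g i j))).
  { intros a b g. induction a as [|a IH]; simpl.
    - symmetry. now apply xsum_false.
    - now rewrite IH, xsum_xorb. }
  revert x. induction k as [|k IH]; intros x; simpl; trivial.
  rewrite <- Hswap. apply xsum_ext. intros v _. apply IH.
Qed.

Lemma box_sum_xorb n k F F' x :
  box_sum n k (fun y => xorb (F y) (F' y)) x =
  xorb (box_sum n k F x) (box_sum n k F' x).
Proof.
  revert x. induction k as [|k IH]; intros x; simpl; trivial.
  rewrite <- xsum_xorb. apply xsum_ext. intros v _. apply IH.
Qed.

Lemma box_sum_false n k F x :
  (forall y, in_box n k x y -> F y = false) -> box_sum n k F x = false.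
Proof.
  revert x. induction k as [|k IH]; intros x H; simpl.
  - apply H. split; auto; lia.
  - apply xsum_false. intros v Hv. apply IH. intros y Hy. apply H.
    eapply in_box_S; eauto.
Qed.

Lemma box_sum_true_ex n k F x :
  box_sum n k F x = true -> exists y, in_box n k x y /\ F y = true.
Proof.
  revert x. induction k as [|k IH]; intros x H; simpl in H.
  - exists x. split; auto. split; auto; lia.
  - apply xsum_true_ex in H. destruct H as (v & Hv & H).
    destruct (IH _ H) as (y & Hy & HF). exists y. split; auto.
    eapply in_box_S; eauto.
Qed.

Lemma box_sum_shift n k j F x :
  k <= j -> box_sum n k (fun y => F (shift y j)) x = box_sum n k F (shift x j).
Proof.
  revert x. induction k as [|k IH]; intros x H; simpl; trivial.
  apply xsum_ext. intros v _. rewrite IH by lia. f_equal. upd_solve.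
Qed.

(** Coordinate [k] is the outermost free one, so the differences along it collapse to the two
    opposite facets. *)
Lemma box_sum_telescope n k F x :
  box_sum n (S k) (fun y => xorb (F (shift y k)) (F y)) x =
  xorb (box_sum n k F (upd x k n)) (box_sum n k F (upd x k 0)).
Proof.
  rewrite <- (xsum_telescope n (fun v => box_sum n k F (upd x k v))).
  simpl. apply xsum_ext. intros v _.
  rewrite box_sum_xorb, box_sum_shift by lia. do 2 f_equal.
  upd_solve.
Qed.

(** The free coordinates above [j] are peeled off until [j] is outermost; then both facets left by
    telescoping contribute zero. *)
Lemma box_sum_difference_vanishes n k j F x :
  j < k ->
  (forall y, y j = 0 \/ y j = n -> F y = false) ->
  box_sum n k (fun y => xorb (F (shift y j)) (F y)) x = false.
Proof.
  revert x. induction k as [|k IH]; intros x Hj H; [lia|].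
  destruct (Nat.eq_dec j k) as [->|Hjk].
  - rewrite box_sum_telescope, !box_sum_false; trivial.
    + intros y [Hy _]. apply H. left. rewrite Hy by lia. apply upd_same.
    + intros y [Hy _]. apply H. right. rewrite Hy by lia. apply upd_same.
  - simpl. apply xsum_false. intros v _. apply IH; auto; lia.
Qed.

Section KuhnLabels.

Variables (d n : nat) (l : nat -> (nat -> nat) -> bool).
Hypothesis label_low : forall i x, i < d -> x i = 0 -> l i x = false.
Hypothesis label_high : forall i x, i < d -> x i = n -> l i x = true.

(* Discrete Stokes: on a facet x_j = 0 or x_j = n with j < k the label j is
   constant, so [cup k] vanishes there and only the facet x_k = n contributes. *)
Lemma box_sum_cup k :
  n <> 0 -> k <= d -> box_sum n k (cup d l k (fun i => i <? k)) (fun _ => n) = true.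
Proof.
  intros Hn. induction k as [|k IH]; intros Hk; [reflexivity|].
  set (A := fun i => i <? S k).
  rewrite (box_sum_ext _ _ _ (fun y => xsum d (fun j => A j &&
     xorb (l k (shift y j) && cup d l k (drop A j) (shift y j))
          (l k y && cup d l k (drop A j) y)))) by reflexivity.
  rewrite box_sum_xsum, (xsum_single d k); [|lia|].
  - rewrite (box_sum_ext _ _ _ (fun y =>
      xorb (l k (shift y k) && cup d l k (drop A k) (shift y k))
           (l k y && cup d l k (drop A k) y))).
    2:{ intros y _. unfold A at 1. destruct (Nat.ltb_spec k (S k)); [reflexivity|lia]. }
    rewrite (box_sum_telescope n k (fun y => l k y && cup d l k (drop A k) y)).
    rewrite (box_sum_false n k _ (upd _ k 0)).
    2:{ intros y [Hy _]. rewrite label_low; [reflexivity|lia|].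
        rewrite Hy by lia. apply upd_same. }
    rewrite xorb_false_r. rewrite <- IH by lia.
    replace (upd (fun _ => n) k n) with (fun _ : nat => n) by upd_solve.
    apply box_sum_ext. intros y [Hy _].
    rewrite label_high; [simpl|lia|apply Hy; lia]. f_equal.
    apply functional_extensionality. intros i. unfold drop, A.
    destruct (Nat.eqb_spec i k), (Nat.ltb_spec i (S k)), (Nat.ltb_spec i k);
      simpl; try reflexivity; lia.
  - intros j Hj Hjk. unfold A at 1. destruct (Nat.ltb_spec j (S k)) as [Hlt|]; simpl.
    2:{ apply xsum_false. intros v _. now apply box_sum_false. }
    apply (box_sum_difference_vanishes n (S k) j
             (fun y => l k y && cup d l k (drop A j) y)); [lia|].
    intros y Hy. destruct (cup d l k (drop A j) y) eqn:E; [|apply andb_false_r].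
    exfalso. destruct (cup_flip _ _ _ _ _ E j) as (u & v & Hu & Hv & Hlu & Hlv); [lia|].
    assert (Hc : forall u, in_cube (drop A j) y u -> u j = y j).
    { intros w Hw. destruct (Hw j) as [?|[Hf _]]; trivial.
      unfold drop in Hf. rewrite Nat.eqb_refl, andb_false_r in Hf. discriminate. }
    apply Hc in Hu. apply Hc in Hv. destruct Hy as [Hy|Hy].
    + rewrite label_low in Hlv; [discriminate|lia|congruence].
    + rewrite label_high in Hlu; [discriminate|lia|congruence].
Qed.

(** The full product has odd total over the grid, so it is nonzero on some cube, and there every
    label takes both values. *)
Lemma kuhn_cube :
  n <> 0 ->
  exists x, (forall i, i < d -> x i < n) /\
    forall i, i < d -> exists y z,
      (forall j, x j <= y j <= S (x j)) /\ (forall j, x j <= z j <= S (x j)) /\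
      l i y = false /\ l i z = true.
Proof.
  intros Hn. pose proof (box_sum_cup d Hn (le_n d)) as H.
  apply box_sum_true_ex in H. destruct H as (x & [_ Hx] & H).
  exists x. split; trivial. intros i Hi.
  destruct (cup_flip _ _ _ _ _ H i Hi) as (y & z & Hy & Hz & Hl).
  exists y, z. split; [|split; trivial]; intros j;
    [destruct (Hy j)|destruct (Hz j)]; lia.
Qed.

End KuhnLabels.

End KuhnLemma.

(** * Brouwer's fixed point theorem on boxes *)

Lemma Un_cv_const (c : R) : Un_cv (fun _ => c) c.
Proof.
  intros eps He. exists 0%nat. intros n _. unfold Rdist.
  rewrite Rminus_diag, Rabs_R0. lra.
Qed.

Lemma Un_cv_ext (u v : nat -> R) l :
  (forall n, u n = v n) -> Un_cv u l -> Un_cv v l.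
Proof.
  intros H Hu eps He. destruct (Hu eps He) as [N HN]. exists N.
  intros n Hn. rewrite <- H. auto.
Qed.

Lemma Un_cv_dominated (u e : nat -> R) l :
  (forall n, Rabs (u n - l) <= e n) -> Un_cv e 0 -> Un_cv u l.
Proof.
  intros H He eps Heps. destruct (He eps Heps) as [N HN]. exists N.
  intros n Hn. specialize (HN n Hn). unfold Rdist in *.
  rewrite Rminus_0_r in HN. pose proof (Rle_abs (e n)). specialize (H n). lra.
Qed.

Lemma Un_cv_subseq (u : nat -> R) l (phi : nat -> nat) :
  (forall n, (n <= phi n)%nat) -> Un_cv u l -> Un_cv (fun n => u (phi n)) l.
Proof.
  intros H Hu eps He. destruct (Hu eps He) as [N HN]. exists N.
  intros n Hn. apply HN. specialize (H n). lia.
Qed.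

Lemma inv_INR_cv : Un_cv (fun n => / INR (S n)) 0.
Proof.
  apply Un_cv_ext with (2 := RinvN_cv). intros n. simpl pos.
  now rewrite S_INR.
Qed.

Lemma increasing_ge_id (phi : nat -> nat) :
  (forall n, (phi n < phi (S n))%nat) -> forall n, (n <= phi n)%nat.
Proof. intros H n. induction n; [lia|]. specialize (H n). lia. Qed.

Lemma increasing_lt (phi : nat -> nat) :
  (forall n, (phi n < phi (S n))%nat) ->
  forall n m, (n < m)%nat -> (phi n < phi m)%nat.
Proof.
  intros H n m Hm. induction Hm; [apply H|]. specialize (H m). lia.
Qed.

Lemma bounded_subsequence (u : nat -> R) a b :
  (forall n, a <= u n <= b) ->
  exists phi l, (forall n, (phi n < phi (S n))%nat) /\ Un_cv (fun n => u (phi n)) l.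
Proof.
  intros H.
  destruct (Bolzano_Weierstrass u _ (compact_P3 a b) H) as [l Hl].
  assert (Hnext : forall N, exists p, (N < p)%nat /\ Rabs (u p - l) < / INR (S N)).
  { intros N. assert (Hpos : 0 < / INR (S N)) by (apply Rinv_0_lt_compat, lt_0_INR; lia).
    destruct (Hl (disc l (mkposreal _ Hpos)) (S N)) as (p & Hp & Hd).
    - exists (mkposreal _ Hpos). intros x Hx. exact Hx.
    - exists p. split; [lia|]. exact Hd. }
  destruct (choice _ Hnext) as [next Hn].
  (* Feeding each index back into [next] gives strict increase; since [phi n > n], the closeness
     [/ INR (S (phi n))] improves on the rate needed at the next index. *)
  set (phi := fix phi n := match n with O => next O | S m => next (phi m) end).
  assert (Hinc : forall n, (phi n < phi (S n))%nat) by (intros n; simpl; apply Hn).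
  assert (Hlt : forall n, (n < phi n)%nat).
  { intros n. induction n as [|n IH]; [apply Hn|]. specialize (Hinc n). lia. }
  exists phi, l. split; trivial.
  apply Un_cv_dominated with (2 := inv_INR_cv).
  intros [|n]; simpl phi; [apply Rlt_le, Hn|].
  destruct (Hn (phi n)) as [_ Hd].
  eapply Rle_trans; [apply Rlt_le, Hd|].
  apply Rinv_le_contravar; [apply lt_0_INR; lia|]. apply le_INR.
  specialize (Hlt n). lia.
Qed.

(** Coordinates are handled one at a time; refining the subsequence keeps the limits already
    obtained. *)
Lemma bounded_subsequence_coords d (a b : nat -> R) (X : nat -> nat -> R) :
  (forall n i, a i <= X n i <= b i) ->
  exists phi x, (forall n, (phi n < phi (S n))%nat) /\
    forall i, (i < d)%nat -> Un_cv (fun n => X (phi n) i) (x i).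
Proof.
  intros H. induction d as [|d IH].
  - exists (fun n => n), (fun _ => 0). split; intros; lia.
  - destruct IH as (phi & x & Hphi & Hx).
    destruct (bounded_subsequence (fun n => X (phi n) d) (a d) (b d))
      as (psi & l & Hpsi & Hl); [intros; apply H|].
    exists (fun n => phi (psi n)), (fun i => if i =? d then l else x i)%nat.
    split.
    + intros n. apply increasing_lt; auto.
    + intros i Hi. destruct (Nat.eqb_spec i d) as [->|Hid]; trivial.
      apply (Un_cv_subseq (fun n => X (phi n) i)); [|apply Hx; lia].
      now apply increasing_ge_id.
Qed.

(** On finer and finer grids, label [i] records whether [f i] lies below or above coordinate [i].
    Kuhn's lemma yields small cubes on which every coordinate shows both signs, and a limit point of
    these cubes is fixed. *)
Lemma brouwer_nat (d : nat) (a b : nat -> R) (f : nat -> (nat -> R) -> R) :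
  (forall i, a i <= b i) ->
  (forall i x, (i < d)%nat -> (forall j, a j <= x j <= b j) -> a i <= f i x <= b i) ->
  (forall i X x, (i < d)%nat -> (forall n j, a j <= X n j <= b j) ->
     (forall j, Un_cv (fun n => X n j) (x j)) -> Un_cv (fun n => f i (X n)) (f i x)) ->
  exists x, (forall j, a j <= x j <= b j) /\ forall i, (i < d)%nat -> f i x = x i.
Proof.
  intros Hab Hf Hcont.
  (* [Nat.min] keeps every integer vector inside the box, and coordinates from [d] on are pinned to
     [a], so the hypotheses on [f] apply to all labelled points. *)
  set (pt := fun n (p : nat -> nat) i =>
     if (i <? d)%nat then a i + (b i - a i) * (INR (Nat.min (p i) (S n)) / INR (S n))
     else a i).
  assert (HSn : forall n, 0 < INR (S n)) by (intros; apply lt_0_INR; lia).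
  assert (Hfrac : forall n k, 0 <= INR (Nat.min k (S n)) / INR (S n) <= 1).
  { intros n k. specialize (HSn n). split.
    - apply Rle_mult_inv_pos; trivial. apply pos_INR.
    - apply Rmult_le_reg_r with (INR (S n)); trivial.
      unfold Rdiv. rewrite Rmult_assoc, Rinv_l, Rmult_1_l, Rmult_1_r by lra.
      apply le_INR. lia. }
  assert (Hpt : forall n p j, a j <= pt n p j <= b j).
  { intros n p j. unfold pt. specialize (Hab j).
    destruct (j <? d)%nat; [|lra]. specialize (Hfrac n (p j)).
    split; nra. }
  (* The two extreme values are imposed to meet the boundary conditions of [kuhn_cube]. They still
     agree with the comparison, because [f] maps the box into itself. *)
  set (lab := fun n i (p : nat -> nat) =>
     if (p i =? 0)%nat then false
     else if (p i =? S n)%nat then true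
     else if Rle_dec (f i (pt n p)) (pt n p i) then true else false).
  assert (Htrue : forall n i p, (i < d)%nat -> lab n i p = true ->
                    f i (pt n p) <= pt n p i).
  { intros n i p Hi. unfold lab.
    destruct (Nat.eqb_spec (p i) 0); [discriminate|].
    destruct (Nat.eqb_spec (p i) (S n)) as [E|].
    - intros _. replace (pt n p i) with (b i); [now apply Hf|].
      unfold pt. destruct (Nat.ltb_spec i d); [|lia].
      rewrite E, Nat.min_id. field. specialize (HSn n). lra.
    - destruct (Rle_dec _ _); [trivial|discriminate]. }
  assert (Hfalse : forall n i p, (i < d)%nat -> lab n i p = false ->
                    pt n p i <= f i (pt n p)).
  { intros n i p Hi. unfold lab.
    destruct (Nat.eqb_spec (p i) 0) as [E|].
    - intros _. replace (pt n p i) with (a i); [now apply Hf|].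
      unfold pt. destruct (Nat.ltb_spec i d); [|lia].
      rewrite E, Nat.min_0_l. change (INR 0) with 0. field. specialize (HSn n). lra.
    - destruct (Nat.eqb_spec (p i) (S n)); [discriminate|].
      destruct (Rle_dec _ _); [discriminate|]. intros _. lra. }
  assert (Hcube : forall n, exists p, forall i, (i < d)%nat -> exists y z,
     ((forall j, p j <= y j <= S (p j)) /\ (forall j, p j <= z j <= S (p j)))%nat /\
     pt n y i <= f i (pt n y) /\ f i (pt n z) <= pt n z i).
  { intros n. destruct (kuhn_cube d (S n) (lab n)) as (p & _ & Hp).
    - intros i x _ E. unfold lab. now rewrite E.
    - intros i x _ E. unfold lab. rewrite E, Nat.eqb_refl. reflexivity.
    - lia.
    - exists p. intros i Hi. destruct (Hp i Hi) as (y & z & Hy & Hz & H0 & H1).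
      exists y, z. auto. }
  destruct (choice _ Hcube) as [p Hp]. clear Hcube.
  destruct (bounded_subsequence_coords d a b (fun n => pt n (p n)))
    as (phi & x0 & Hphi & Hx0); [auto|].
  set (x := fun i => if (i <? d)%nat then x0 i else a i).
  assert (Hx : forall j, Un_cv (fun n => pt (phi n) (p (phi n)) j) (x j)).
  { intros j. unfold x. destruct (Nat.ltb_spec j d) as [Hj|Hj]; [now apply Hx0|].
    apply Un_cv_ext with (2 := Un_cv_const (a j)). intros n. unfold pt.
    destruct (Nat.ltb_spec j d); [lia|reflexivity]. }
  (* All vertices of the chosen cubes share the limit [x], since the mesh tends to 0; the sign
     witnesses may therefore vary with the coordinate. *)
  assert (Hnear : forall q, (forall n j, p n j <= q n j <= S (p n j))%nat ->
            forall j, Un_cv (fun n => pt (phi n) (q (phi n)) j) (x j)).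
  { intros q Hq j.
    replace (x j) with (0 + x j) by ring.
    apply Un_cv_ext with (fun n =>
      (pt (phi n) (q (phi n)) j - pt (phi n) (p (phi n)) j) + pt (phi n) (p (phi n)) j);
      [intros; ring|].
    apply CV_plus; [|apply Hx].
    apply Un_cv_dominated with (fun n => (b j - a j) * / INR (S (phi n))).
    - intros n. rewrite Rminus_0_r. unfold pt. specialize (Hab j).
      specialize (HSn (phi n)). pose proof (Rinv_0_lt_compat _ HSn).
      destruct (j <? d)%nat; [|rewrite Rminus_diag, Rabs_R0; nra].
      replace (_ - _) with ((b j - a j) * / INR (S (phi n)) *
        (INR (Nat.min (q (phi n) j) (S (phi n))) - INR (Nat.min (p (phi n) j) (S (phi n)))))
        by (unfold Rdiv; ring).
      rewrite Rabs_mult, (Rabs_pos_eq ((b j - a j) * _)) by nra.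
      rewrite <- (Rmult_1_r ((b j - a j) * / INR (S (phi n)))) at 2.
      apply Rmult_le_compat_l; [nra|].
      assert (INR (Nat.min (p (phi n) j) (S (phi n))) <= INR (Nat.min (q (phi n) j) (S (phi n))))
        by (apply le_INR; specialize (Hq (phi n) j); lia).
      assert (INR (Nat.min (q (phi n) j) (S (phi n))) <= INR (S (Nat.min (p (phi n) j) (S (phi n)))))
        by (apply le_INR; specialize (Hq (phi n) j); lia).
      rewrite S_INR in *. rewrite Rabs_pos_eq; lra.
    - replace 0 with ((b j - a j) * 0) by ring.
      apply CV_mult; [apply Un_cv_const|].
      apply (Un_cv_subseq (fun n => / INR (S n)));
        [now apply increasing_ge_id|apply inv_INR_cv]. }
  exists x. split.
  { intros j. split.
    - apply Rle_cv_lim with (2 := Un_cv_const (a j)) (3 := Hx j). intros n. apply Hpt.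
    - apply Rle_cv_lim with (2 := Hx j) (3 := Un_cv_const (b j)). intros n. apply Hpt. }
  intros i Hi. apply Rle_antisym.
  - destruct (choice (fun n z => (forall j, p n j <= z j <= S (p n j))%nat /\
                                 f i (pt n z) <= pt n z i)) as [q Hq].
    { intros n. destruct (Hp n i Hi) as (y & z & [_ Hz] & _ & H). eauto. }
    assert (Hq' := Hnear q (fun n => proj1 (Hq n))).
    eapply Rle_cv_lim with (Un := fun n => f i (pt (phi n) (q (phi n)))); [|now apply Hcont|exact (Hq' i)].
    intros n. apply Hq.
  - destruct (choice (fun n z => (forall j, p n j <= z j <= S (p n j))%nat /\
                                 pt n z i <= f i (pt n z))) as [q Hq].
    { intros n. destruct (Hp n i Hi) as (y & z & [Hy _] & H & _). eauto. }
    assert (Hq' := Hnear q (fun n => proj1 (Hq n))).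
    eapply Rle_cv_lim with (Vn := fun n => f i (pt (phi n) (q (phi n)))); [|exact (Hq' i)|now apply Hcont].
    intros n. apply Hq.
Qed.

(** The finite list is indexed by positions and variables outside it are pinned to their lower
    bound. A repeated entry is harmless: only its chosen position [idx v] is read back. *)
Theorem brouwer_box {I : Type} (l : list I) (a b : I -> R) (f : (I -> R) -> I -> R) :
  (forall v, a v <= b v) ->
  (forall x v, In v l -> (forall w, a w <= x w <= b w) -> a v <= f x v <= b v) ->
  (forall X x v, In v l -> (forall n w, a w <= X n w <= b w) ->
     (forall w, a w <= x w <= b w) ->
     (forall w, Un_cv (fun n => X n w) (x w)) -> Un_cv (fun n => f (X n) v) (f x v)) ->
  exists x, (forall w, a w <= x w <= b w) /\ forall v, In v l -> f x v = x v.
Proof.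
  intros Hab Hf Hcont.
  assert (Hidx : forall v, exists k, In v l -> nth_error l k = Some v).
  { intros v. destruct (excluded_middle_informative (In v l)) as [Hv|Hv].
    - destruct (In_nth_error _ _ Hv) as [k Hk]. now exists k.
    - exists 0%nat. contradiction. }
  destruct (choice _ Hidx) as [idx Hi]. clear Hidx.
  set (lo := fun k => match nth_error l k with Some v => a v | None => 0 end).
  set (hi := fun k => match nth_error l k with Some v => b v | None => 0 end).
  set (lift := fun (x : nat -> R) v =>
    if excluded_middle_informative (In v l) then x (idx v) else a v).
  assert (Hlift : forall x, (forall k, lo k <= x k <= hi k) ->
                  forall v, a v <= lift x v <= b v).
  { intros x Hx v. unfold lift. destruct (excluded_middle_informative _) as [Hv|].
    - specialize (Hx (idx v)). unfold lo, hi in Hx. now rewrite (Hi v Hv) in Hx.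
    - specialize (Hab v). lra. }
  destruct (brouwer_nat (length l) lo hi (fun k x =>
     match nth_error l k with Some v => f (lift x) v | None => 0 end))
    as (x & Hx & Hfix).
  - intros k. unfold lo, hi. destruct (nth_error l k); [apply Hab|lra].
  - intros k x _ Hx. unfold lo, hi. destruct (nth_error l k) as [v|] eqn:E; [|lra].
    apply Hf; [eapply nth_error_In; eauto|auto].
  - intros k X x _ HX Hx. destruct (nth_error l k) as [v|] eqn:E; [|apply Un_cv_const].
    apply Hcont; [eapply nth_error_In; eauto|auto| |].
    + apply Hlift. intros j. split.
      * apply Rle_cv_lim with (2 := Un_cv_const (lo j)) (3 := Hx j). intros n. apply HX.
      * apply Rle_cv_lim with (2 := Hx j) (3 := Un_cv_const (hi j)). intros n. apply HX.
    + intros w. unfold lift. destruct (excluded_middle_informative _);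
        [apply Hx|apply Un_cv_const].
  - exists (lift x). split; [now apply Hlift|]. intros v Hv.
    assert (Hlt : (idx v < length l)%nat)
      by (apply nth_error_Some; rewrite (Hi v Hv); discriminate).
    specialize (Hfix _ Hlt). rewrite (Hi v Hv) in Hfix. rewrite Hfix.
    unfold lift. destruct (excluded_middle_informative _); [reflexivity|contradiction].
Qed.

(** * The simultaneous fixed point *)

Lemma rsum_ext {A} (f g : A -> R) l :
  (forall x, In x l -> f x = g x) -> rsum f l = rsum g l.
Proof.
  induction l as [|x l IH]; intros H; simpl; trivial.
  rewrite H by (left; trivial). f_equal. apply IH. intros; apply H; now right.
Qed.

Lemma rsum_plus {A} (f g : A -> R) l :
  rsum (fun x => f x + g x) l = rsum f l + rsum g l.
Proof. induction l as [|x l IH]; simpl; [ring|]. rewrite IH. ring. Qed.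

Lemma rsum_minus {A} (f g : A -> R) l :
  rsum (fun x => f x - g x) l = rsum f l - rsum g l.
Proof. induction l as [|x l IH]; simpl; [ring|]. rewrite IH. ring. Qed.

Lemma rsum_scal {A} c (f : A -> R) l : rsum (fun x => c * f x) l = c * rsum f l.
Proof. induction l as [|x l IH]; simpl; [ring|]. rewrite IH. ring. Qed.

Lemma rsum_scal_r {A} c (f : A -> R) l : rsum (fun x => f x * c) l = rsum f l * c.
Proof. induction l as [|x l IH]; simpl; [ring|]. rewrite IH. ring. Qed.

Lemma rsum_const {A} c (l : list A) : rsum (fun _ => c) l = INR (length l) * c.
Proof.
  induction l as [|x l IH]; [simpl; ring|].
  change (length (x :: l)) with (S (length l)). rewrite S_INR. simpl. rewrite IH. ring.
Qed.

Lemma rsum_zero {A} (f : A -> R) l : (forall x, In x l -> f x = 0) -> rsum f l = 0.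
Proof.
  intros H. rewrite (rsum_ext f (fun _ => 0) l H), rsum_const. ring.
Qed.

Lemma rsum_le {A} (f g : A -> R) l :
  (forall x, In x l -> f x <= g x) -> rsum f l <= rsum g l.
Proof.
  induction l as [|x l IH]; intros H; simpl; [lra|].
  apply Rplus_le_compat; [apply H; now left|apply IH; intros; apply H; now right].
Qed.

Lemma rsum_nonneg {A} (f : A -> R) l : (forall x, In x l -> 0 <= f x) -> 0 <= rsum f l.
Proof.
  intros H. rewrite <- (rsum_zero (fun _ => 0) l) by trivial. now apply rsum_le.
Qed.

Lemma rsum_term_le {A} (f : A -> R) l x :
  (forall y, In y l -> 0 <= f y) -> In x l -> f x <= rsum f l.
Proof.
  induction l as [|y l IH]; intros H Hx; simpl; [contradiction|].
  assert (0 <= f y) by (apply H; now left).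
  assert (Hl : forall z, In z l -> 0 <= f z) by (intros; apply H; now right).
  pose proof (rsum_nonneg f l Hl). destruct Hx as [->|Hx]; [lra|].
  specialize (IH Hl Hx). lra.
Qed.

Lemma rsum_zero_inv {A} (f : A -> R) l :
  (forall y, In y l -> 0 <= f y) -> rsum f l = 0 -> forall x, In x l -> f x = 0.
Proof.
  intros H H0 x Hx. pose proof (rsum_term_le f l x H Hx). specialize (H x Hx). lra.
Qed.

Lemma rsum_abs {A} (f : A -> R) l : Rabs (rsum f l) <= rsum (fun x => Rabs (f x)) l.
Proof.
  induction l as [|x l IH]; simpl; [rewrite Rabs_R0; lra|].
  eapply Rle_trans; [apply Rabs_triang|]. lra.
Qed.

Lemma Rabs_le_between a b : Rabs a <= b -> - b <= a <= b.
Proof. unfold Rabs. destruct (Rcase_abs a); lra. Qed.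

Lemma rsum_swap {A B} (f : A -> B -> R) l m :
  rsum (fun x => rsum (f x) m) l = rsum (fun y => rsum (fun x => f x y) l) m.
Proof.
  induction l as [|x l IH]; simpl.
  - symmetry. now apply rsum_zero.
  - now rewrite IH, rsum_plus.
Qed.

Lemma rsum_app {A} (f : A -> R) l m : rsum f (l ++ m) = rsum f l + rsum f m.
Proof. induction l as [|x l IH]; simpl; [ring|]. rewrite IH. ring. Qed.

Lemma rsum_map {A B} (f : B -> R) (g : A -> B) l :
  rsum f (map g l) = rsum (fun x => f (g x)) l.
Proof. induction l as [|x l IH]; simpl; [ring|]. now rewrite IH. Qed.

Lemma rsum_flat_map {A B} (f : B -> R) (g : A -> list B) l :
  rsum f (flat_map g l) = rsum (fun x => rsum f (g x)) l.
Proof. induction l as [|x l IH]; simpl; [ring|]. now rewrite rsum_app, IH. Qed.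

Lemma rsum_list_prod {A B} (f : A * B -> R) l m :
  rsum f (list_prod l m) = rsum (fun x => rsum (fun y => f (x, y)) m) l.
Proof.
  induction l as [|x l IH]; simpl; [ring|]. now rewrite rsum_app, rsum_map, IH.
Qed.

Lemma rsum_filter {A} (f : A -> R) p l :
  rsum f (filter p l) = rsum (fun x => if p x then f x else 0) l.
Proof.
  induction l as [|x l IH]; simpl; [ring|].
  destruct (p x); simpl; rewrite IH; ring.
Qed.

Lemma rsum_pick {A} (dec : forall x y : A, {x = y} + {x <> y}) (f : A -> R) l z :
  NoDup l -> In z l -> rsum (fun x => if dec z x then f x else 0) l = f z.
Proof.
  induction l as [|x l IH]; intros Hd Hz; [contradiction|].
  inversion Hd as [|? ? Hx Hl]; subst. simpl. destruct (dec z x) as [->|Hne].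
  - rewrite rsum_zero; [ring|]. intros y Hy.
    destruct (dec x y) as [->|]; [contradiction|trivial].
  - destruct Hz as [->|Hz]; [contradiction|]. rewrite IH by trivial. ring.
Qed.

Lemma rsum_cv {A} (f : nat -> A -> R) g l :
  (forall x, In x l -> Un_cv (fun n => f n x) (g x)) ->
  Un_cv (fun n => rsum (f n) l) (rsum g l).
Proof.
  induction l as [|x l IH]; intros H; simpl; [apply Un_cv_const|].
  apply CV_plus; [apply H; now left|]. apply IH. intros; apply H; now right.
Qed.

Lemma rprod_cv {A} (f : nat -> A -> R) g l :
  (forall x, In x l -> Un_cv (fun n => f n x) (g x)) ->
  Un_cv (fun n => rprod (f n) l) (rprod g l).
Proof.
  induction l as [|x l IH]; intros H; simpl; [apply Un_cv_const|].
  apply CV_mult; [apply H; now left|]. apply IH. intros; apply H; now right.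
Qed.

Lemma rprod_unit {A} (f : A -> R) l :
  (forall x, In x l -> 0 <= f x <= 1) -> 0 <= rprod f l <= 1.
Proof.
  induction l as [|x l IH]; intros H; simpl; [lra|].
  assert (0 <= f x <= 1) by (apply H; now left).
  assert (0 <= rprod f l <= 1) by (apply IH; intros; apply H; now right).
  split; nra.
Qed.

(** * Continuous truncation and normalisation *)

Lemma Un_cv_lipschitz (f : R -> R) u l :
  (forall x y, Rabs (f x - f y) <= Rabs (x - y)) ->
  Un_cv u l -> Un_cv (fun n : nat => f (u n)) (f l).
Proof.
  intros Hf H. apply Un_cv_dominated with (fun n => Rabs (u n - l)); [intros; apply Hf|].
  rewrite <- Rabs_R0 at 1. apply (cv_cvabs (fun n => u n - l) 0).
  rewrite <- (Rminus_diag l). apply CV_minus; [trivial|apply Un_cv_const].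
Qed.

Lemma Rmax_lipschitz c x y : Rabs (Rmax c x - Rmax c y) <= Rabs (x - y).
Proof.
  unfold Rmax. destruct (Rle_dec c x), (Rle_dec c y);
    unfold Rabs; repeat destruct (Rcase_abs _); lra.
Qed.

Lemma Un_cv_Rdiv u v l m :
  m <> 0 -> Un_cv u l -> Un_cv v m -> Un_cv (fun n : nat => u n / v n) (l / m).
Proof.
  intros Hm Hu Hv. apply CV_mult; trivial.
  apply (continuity_seq Rinv); trivial.
  apply (continuity_pt_inv id); [apply derivable_continuous_pt, derivable_pt_id|trivial].
Qed.

(** Serves twice: to keep [h] in a bounded box, and to extend weighting functions from [0,1] to the
    whole line. *)
Definition clip (lo hi x : R) : R := Rmax lo (Rmin x hi).

Lemma clip_bounds lo hi x : lo <= hi -> lo <= clip lo hi x <= hi.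
Proof.
  intros H. unfold clip, Rmax, Rmin.
  destruct (Rle_dec x hi); destruct (Rle_dec _ _); lra.
Qed.

Lemma clip_id lo hi x : lo <= x <= hi -> clip lo hi x = x.
Proof.
  intros H. unfold clip, Rmax, Rmin.
  destruct (Rle_dec x hi); destruct (Rle_dec _ _); lra.
Qed.

Lemma clip_lipschitz lo hi x y : Rabs (clip lo hi x - clip lo hi y) <= Rabs (x - y).
Proof.
  eapply Rle_trans; [apply Rmax_lipschitz|].
  unfold Rmin. destruct (Rle_dec x hi), (Rle_dec y hi);
    unfold Rabs; repeat destruct (Rcase_abs _); lra.
Qed.

(* Sends a nonnegative vector to the simplex, continuously and without
   division by 0: missing mass is spread uniformly, excess mass divided out. *)
Definition normalize {A} (l : list A) (y : A -> R) (a : A) : R :=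
  (y a + Rmax 0 (1 - rsum y l) / INR (length l)) / Rmax 1 (rsum y l).

Lemma length_pos {A} (l : list A) : l <> [] -> 0 < INR (length l).
Proof. intros H. apply lt_0_INR. destruct l; [congruence|simpl; lia]. Qed.

Lemma normalize_sum {A} (l : list A) y : l <> [] -> rsum (normalize l y) l = 1.
Proof.
  intros Hl. unfold normalize, Rdiv at 1. rewrite rsum_scal_r, rsum_plus, rsum_const.
  pose proof (length_pos l Hl).
  replace (INR (length l) * (Rmax 0 (1 - rsum y l) / INR (length l)))
    with (Rmax 0 (1 - rsum y l)) by (field; lra).
  assert (E : rsum y l + Rmax 0 (1 - rsum y l) = Rmax 1 (rsum y l))
    by (unfold Rmax; destruct (Rle_dec 0 _), (Rle_dec 1 _); lra).
  rewrite E. apply Rinv_r. pose proof (Rmax_l 1 (rsum y l)). lra.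
Qed.

Lemma normalize_unit {A} (l : list A) y a :
  (forall b, In b l -> 0 <= y b) -> In a l -> 0 <= normalize l y a <= 1.
Proof.
  intros Hy Ha.
  assert (Hl : l <> []) by (intros ->; contradiction).
  assert (Hnn : forall b, In b l -> 0 <= normalize l y b).
  { intros b Hb. unfold normalize. apply Rle_mult_inv_pos.
    - apply Rplus_le_le_0_compat; [auto|].
      apply Rle_mult_inv_pos; [apply Rmax_l|now apply length_pos].
    - pose proof (Rmax_l 1 (rsum y l)). lra. }
  split; [auto|]. rewrite <- (normalize_sum l y Hl). now apply rsum_term_le.
Qed.

Lemma normalize_excess {A} (l : list A) y a :
  1 <= rsum y l -> normalize l y a = y a / rsum y l.
Proof.
  intros H. unfold normalize. rewrite Rmax_left, Rmax_right by lra.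
  unfold Rdiv. ring.
Qed.

Lemma normalize_cv {A} (l : list A) (y : nat -> A -> R) z a :
  In a l -> (forall b, In b l -> Un_cv (fun n => y n b) (z b)) ->
  Un_cv (fun n => normalize l (y n) a) (normalize l z a).
Proof.
  intros Ha H. unfold normalize.
  apply Un_cv_Rdiv.
  - pose proof (Rmax_l 1 (rsum z l)). lra.
  - apply CV_plus; [auto|]. apply CV_mult; [|apply Un_cv_const].
    apply (Un_cv_lipschitz (Rmax 0)); [apply Rmax_lipschitz|]. apply CV_minus; [apply Un_cv_const|now apply rsum_cv].
  - apply (Un_cv_lipschitz (Rmax 1)); [apply Rmax_lipschitz|]. now apply rsum_cv.
Qed.

(* Nash's argument: the excess mass of [psi + (q - v)^+] is proportional to
   [psi], while [psi] averages [q - v] to zero, so all positive parts vanish. *)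
Lemma nash_improvement {A} (l : list A) (psi q : A -> R) (v : R) :
  l <> [] ->
  (forall a, In a l -> 0 <= psi a) ->
  (forall a, In a l -> normalize l (fun b => psi b + Rmax 0 (q b - v)) a = psi a) ->
  rsum (fun a => psi a * q a) l = v ->
  forall a, In a l -> q a <= v.
Proof.
  intros Hl Hpsi Hfix Hv.
  set (y := fun b => psi b + Rmax 0 (q b - v)) in *.
  assert (Hy : forall a, In a l -> 0 <= y a).
  { intros a Ha. unfold y. pose proof (Rmax_l 0 (q a - v)). specialize (Hpsi a Ha). lra. }
  assert (Hsum : rsum psi l = 1).
  { rewrite <- (normalize_sum l y Hl). apply rsum_ext.
    intros a Ha. now rewrite Hfix. }
  set (E := rsum (fun b => Rmax 0 (q b - v)) l).
  assert (HE : 0 <= E) by (apply rsum_nonneg; intros; apply Rmax_l).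
  assert (HyE : rsum y l = 1 + E) by (unfold y; rewrite rsum_plus, Hsum; reflexivity).
  (* Clearing the denominator [1 + E] in the fixed-point equation. *)
  assert (Hprop : forall a, In a l -> Rmax 0 (q a - v) = E * psi a).
  { intros a Ha. specialize (Hfix a Ha). rewrite normalize_excess in Hfix by lra.
    rewrite HyE in Hfix. unfold y in Hfix.
    apply Rmult_eq_compat_r with (r := 1 + E) in Hfix.
    unfold Rdiv in Hfix. rewrite Rmult_assoc, Rinv_l in Hfix by lra. lra. }
  (* A squared positive part equals [E * psi a * (q a - v)], and [v] is the [psi]-average of [q]. *)
  assert (Hsq : rsum (fun a => Rmax 0 (q a - v) * Rmax 0 (q a - v)) l = 0).
  { rewrite (rsum_ext _ (fun a => E * (psi a * q a) - E * v * psi a)).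
    - rewrite rsum_minus, !rsum_scal, Hv, Hsum. ring.
    - intros a Ha. rewrite <- (Rmult_assoc E (psi a)), <- Hprop by trivial.
      replace (E * v * psi a) with (v * (E * psi a)) by ring.
      rewrite <- Hprop by trivial.
      unfold Rmax. destruct (Rle_dec 0 (q a - v)); ring. }
  intros a Ha.
  assert (Hz := rsum_zero_inv _ l (fun b _ => Rle_0_sqr (Rmax 0 (q b - v))) Hsq a Ha).
  apply Rsqr_0_uniq in Hz. pose proof (Rmax_r 0 (q a - v)). lra.
Qed.

(** * The fixed-point system over abstract finite state spaces *)

Section FixedPoint.

Context {A : Type}.

(** A single index type for policies, stationary laws and relative values, so that Brouwer's theorem
    applies to one vector. *)
Inductive var :=
| VPsi (j s : nat) (a : A)
| VPi (j s : nat)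
| VH (j s : nat).

Variables (N : nat) (sl : nat -> list nat) (al : nat -> nat -> list A).
Variables (K : nat -> nat -> A -> nat -> R) (lam : nat -> R).
(** The reward may depend on the whole vector; this is the only coupling between players. *)
Variable r : nat -> (var -> R) -> nat -> A -> R.

Hypothesis sl_nonempty : forall j, (j < N)%nat -> sl j <> [].
Hypothesis al_nonempty : forall j s, (j < N)%nat -> In s (sl j) -> al j s <> [].
Hypothesis lam_pos : forall j, (j < N)%nat -> 0 < lam j.
Hypothesis K_minor : forall j s a s', (j < N)%nat ->
  In s (sl j) -> In a (al j s) -> In s' (sl j) -> lam j <= K j s a s'.
Hypothesis K_sum : forall j s a, (j < N)%nat ->
  In s (sl j) -> In a (al j s) -> rsum (K j s a) (sl j) = 1.
Hypothesis r_cv : forall j s a X x, (j < N)%nat ->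
  (forall w, Un_cv (fun n => X n w) (x w)) ->
  Un_cv (fun n => r j (X n) s a) (r j x s a).
Hypothesis r_bounded : forall j, (j < N)%nat -> exists B, 0 <= B /\ forall x s a, Rabs (r j x s a) <= B.

Definition vars : list var :=
  flat_map (fun j => map (VPi j) (sl j) ++ map (VH j) (sl j) ++
    flat_map (fun s => map (VPsi j s) (al j s)) (sl j)) (seq 0 N).

Lemma in_vars v : In v vars <->
  match v with
  | VPsi j s a => (j < N)%nat /\ In s (sl j) /\ In a (al j s)
  | VPi j s | VH j s => (j < N)%nat /\ In s (sl j)
  end.
Proof.
  unfold vars. rewrite in_flat_map. split.
  - intros (j & Hj & Hv). apply in_seq in Hj.
    rewrite !in_app_iff, !in_map_iff, in_flat_map in Hv.
    destruct Hv as [(s & <- & Hs)|[(s & <- & Hs)|(s & Hs & Hv)]].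
    1, 2: split; trivial; lia.
    apply in_map_iff in Hv. destruct Hv as (a & <- & Ha). repeat split; trivial; lia.
  - intros H. destruct v as [j s a|j s|j s]; exists j;
      rewrite in_seq, !in_app_iff, !in_map_iff, in_flat_map; (split; [lia|]).
    + right; right. exists s. split; [tauto|]. apply in_map. tauto.
    + left. exists s. tauto.
    + right; left. exists s. tauto.
Qed.

(* Subtracting [lam] makes the transition kernel strictly substochastic, which
   turns the average-reward evaluation equation into a contraction. *)
Definition qval (x : var -> R) j s a : R :=
  r j x s a + rsum (fun s' => (K j s a s' - lam j) * x (VH j s')) (sl j).

Definition flow (x : var -> R) j s' : R :=
  rsum (fun s => rsum (fun a => x (VPi j s) * x (VPsi j s a) * K j s a s') (al j s)) (sl j).

(** The normalisation of [flow] and the clipping of [h] make the box invariant even where [x] holds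
    no probability vectors; at a fixed point both turn out to be inactive. *)
Definition update (M : nat -> R) (x : var -> R) (v : var) : R :=
  match v with
  | VPsi j s a =>
      normalize (al j s) (fun b => x (VPsi j s b) + Rmax 0 (qval x j s b - x (VH j s))) a
  | VPi j s => normalize (sl j) (flow x j) s
  | VH j s =>
      clip (- M j) (M j) (rsum (fun a => x (VPsi j s a) * qval x j s a) (al j s))
  end.

Lemma qval_cv X x j s a : (j < N)%nat ->
  (forall w, Un_cv (fun n => X n w) (x w)) ->
  Un_cv (fun n => qval (X n) j s a) (qval x j s a).
Proof.
  intros Hj H. apply CV_plus; [now apply r_cv|]. apply rsum_cv. intros s' _.
  apply CV_mult; [apply Un_cv_const|apply H].
Qed.

Lemma update_cv M X x v : In v vars ->
  (forall w, Un_cv (fun n => X n w) (x w)) ->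
  Un_cv (fun n => update M (X n) v) (update M x v).
Proof.
  intros Hv H. apply in_vars in Hv. destruct v as [j s a|j s|j s]; simpl.
  - apply (normalize_cv _ (fun n b => X n (VPsi j s b) +
      Rmax 0 (qval (X n) j s b - X n (VH j s)))); [tauto|]. intros b _.
    apply CV_plus; [apply H|]. apply (Un_cv_lipschitz (Rmax 0)); [apply Rmax_lipschitz|].
    apply CV_minus; [apply qval_cv; tauto|apply H].
  - apply (normalize_cv _ (fun n => flow (X n) j)); [tauto|]. intros s' _.
    apply rsum_cv. intros s0 _. apply rsum_cv. intros a _.
    apply CV_mult; [apply CV_mult; apply H|apply Un_cv_const].
  - apply (Un_cv_lipschitz (clip _ _)); [apply clip_lipschitz|]. apply rsum_cv. intros a _.
    apply CV_mult; [apply H|apply qval_cv; tauto].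
Qed.

Theorem fixed_point_equilibrium :
  exists x : var -> R, forall j, (j < N)%nat ->
    (forall s a, In s (sl j) -> In a (al j s) -> 0 <= x (VPsi j s a)) /\
    (forall s, In s (sl j) -> rsum (fun a => x (VPsi j s a)) (al j s) = 1) /\
    (forall s, In s (sl j) -> 0 <= x (VPi j s)) /\
    rsum (fun s => x (VPi j s)) (sl j) = 1 /\
    (forall s', In s' (sl j) -> flow x j s' = x (VPi j s')) /\
    (forall s a, In s (sl j) -> In a (al j s) -> qval x j s a <= x (VH j s)) /\
    (forall s, In s (sl j) ->
       rsum (fun a => x (VPsi j s a) * qval x j s a) (al j s) = x (VH j s)).
Proof.
  destruct (choice (fun j B => (j < N)%nat ->
    0 <= B /\ forall x s a, Rabs (r j x s a) <= B)) as [B HB].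
  { intros j. destruct (lt_dec j N) as [Hj|Hj].
    - destruct (r_bounded j Hj) as [B HB]. now exists B.
    - exists 0. contradiction. }
  assert (Hn : forall j, (j < N)%nat -> 0 < INR (length (sl j)) * lam j).
  { intros j Hj. apply Rmult_lt_0_compat; auto. apply length_pos; auto. }
  (* [M] solves [B + (1 - |S| lam) M = M], the bound reproduced by one evaluation step. The absolute
     value keeps the box nonempty also for indices [j >= N]. *)
  set (M := fun j => Rabs (B j / (INR (length (sl j)) * lam j))).
  set (lo := fun v => match v with VH j _ => - M j | _ => 0 end).
  set (hi := fun v => match v with VH j _ => M j | _ => 1 end).
  assert (HM : forall j, 0 <= M j) by (intros; apply Rabs_pos).
  destruct (brouwer_box vars lo hi (update M)) as (x & Hx & Hfix).
  - intros [j s a|j s|j s]; simpl; try lra. specialize (HM j). lra.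
  - intros x v Hv Hx. apply in_vars in Hv. destruct v as [j s a|j s|j s]; simpl.
    + apply normalize_unit; try tauto.
      intros b _. pose proof (Hx (VPsi j s b)) as H. simpl in H.
      pose proof (Rmax_l 0 (qval x j s b - x (VH j s))). lra.
    + apply normalize_unit; try tauto.
      intros s' Hs'. apply rsum_nonneg. intros s0 Hs0. apply rsum_nonneg. intros a Ha.
      pose proof (Hx (VPsi j s0 a)) as H1. pose proof (Hx (VPi j s0)) as H2.
      simpl in H1, H2. destruct Hv as [Hj _].
      pose proof (K_minor j s0 a s' Hj Hs0 Ha Hs'). pose proof (lam_pos j Hj).
      apply Rmult_le_pos; [apply Rmult_le_pos|]; lra.
    + apply clip_bounds. specialize (HM j). lra.
  - intros X x v Hv _ _ H. now apply update_cv.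
  - exists x. intros j Hj.
    assert (Hpsi : forall s a, 0 <= x (VPsi j s a) <= 1) by (intros; apply (Hx (VPsi j s a))).
    assert (Hpi : forall s, 0 <= x (VPi j s) <= 1) by (intros; apply (Hx (VPi j s))).
    assert (Hh : forall s, - M j <= x (VH j s) <= M j) by (intros; apply (Hx (VH j s))).
    assert (Fpsi : forall s a, In s (sl j) -> In a (al j s) ->
      normalize (al j s) (fun b => x (VPsi j s b) + Rmax 0 (qval x j s b - x (VH j s))) a
      = x (VPsi j s a)) by (intros; apply (Hfix (VPsi j s a)), in_vars; auto).
    assert (Fpi : forall s, In s (sl j) -> normalize (sl j) (flow x j) s = x (VPi j s))
      by (intros; apply (Hfix (VPi j s)), in_vars; auto).
    assert (Fh : forall s, In s (sl j) -> clip (- M j) (M j)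
       (rsum (fun a => x (VPsi j s a) * qval x j s a) (al j s)) = x (VH j s))
      by (intros; apply (Hfix (VH j s)), in_vars; auto).
    (* Total mass one is not built into the box; it holds because fixed rows are outputs of
       [normalize]. *)
    assert (Spsi : forall s, In s (sl j) -> rsum (fun a => x (VPsi j s a)) (al j s) = 1).
    { intros s Hs. rewrite <- (normalize_sum (al j s)
        (fun b => x (VPsi j s b) + Rmax 0 (qval x j s b - x (VH j s)))) by auto.
      apply rsum_ext. intros a Ha. symmetry. auto. }
    assert (Spi : rsum (fun s => x (VPi j s)) (sl j) = 1).
    { rewrite <- (normalize_sum (sl j) (flow x j)) by auto.
      apply rsum_ext. intros s Hs. symmetry. auto. }
    assert (Hq : forall s a, In s (sl j) -> In a (al j s) -> Rabs (qval x j s a) <= M j).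
    { intros s a Hs Ha. unfold qval.
      eapply Rle_trans; [apply Rabs_triang|].
      eapply Rle_trans; [apply Rplus_le_compat; [now apply HB|apply rsum_abs]|].
      eapply Rle_trans; [apply Rplus_le_compat_l, (rsum_le _
        (fun s' => (K j s a s' - lam j) * M j))|].
      - intros s' Hs'. rewrite Rabs_mult.
        pose proof (K_minor j s a s' Hj Hs Ha Hs').
        rewrite (Rabs_pos_eq (K j s a s' - lam j)) by lra.
        apply Rmult_le_compat_l; [lra|]. apply Rabs_le, Hh.
      - rewrite rsum_scal_r, rsum_minus, K_sum, rsum_const by auto.
        specialize (Hn j Hj). pose proof (proj1 (HB j Hj)) as HB0.
        assert (E : M j * (INR (length (sl j)) * lam j) = B j).
        { unfold M. rewrite Rabs_pos_eq.
          - field. split; intros E; rewrite E in Hn; lra.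
          - now apply Rle_mult_inv_pos. }
        lra. }
    assert (Eh : forall s, In s (sl j) ->
       rsum (fun a => x (VPsi j s a) * qval x j s a) (al j s) = x (VH j s)).
    { intros s Hs. rewrite <- Fh by trivial. rewrite clip_id; trivial.
      apply Rabs_le_between. eapply Rle_trans; [apply rsum_abs|].
      rewrite <- (Rmult_1_l (M j)), <- (Spsi s Hs), <- rsum_scal_r.
      apply rsum_le. intros a Ha. rewrite Rabs_mult, Rabs_pos_eq by apply Hpsi.
      apply Rmult_le_compat_l; [apply Hpsi|auto]. }
    repeat split; trivial; try (intros; apply Hpsi); try (intros; apply Hpi).
    + intros s' Hs'. rewrite <- Fpi by trivial.
      (* The flow already has mass one, so its normalisation does nothing and [pi] is truly
         stationary. *)
      assert (E : rsum (flow x j) (sl j) = 1).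
      { unfold flow. rewrite rsum_swap, <- Spi. apply rsum_ext. intros s Hs.
        rewrite rsum_swap. rewrite (rsum_ext _ (fun a => x (VPi j s) * x (VPsi j s a))).
        - rewrite rsum_scal, Spsi by trivial. ring.
        - intros a Ha. rewrite rsum_scal, K_sum by trivial. ring. }
      rewrite normalize_excess, E by lra. field.
    + intros s a Hs Ha. apply (nash_improvement (al j s) (fun b => x (VPsi j s b))
        (qval x j s)); auto. intros; apply Hpsi.
Qed.

End FixedPoint.
Arguments var : clear implicits.

(** * State-action laws under a policy *)

Definition zsummable (f : Z -> R) (l : R) : Prop :=
  exists a b, infinite_sum (fun n => f (Z.of_nat n)) a /\
              infinite_sum (fun n => f (- Z.of_nat n - 1)%Z) b /\ a + b = l.

Lemma series_value_eq u l : infinite_sum u l -> series_value u = l.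
Proof.
  intros H. unfold series_value. apply (uniqueness_sum u); trivial.
  apply (epsilon_spec (inhabits 0)). now exists l.
Qed.

(** [zsum] takes its values from [epsilon], so it can be computed with only after convergence is
    known. *)
Lemma zsum_eq f l : zsummable f l -> zsum f = l.
Proof.
  intros (a & b & Ha & Hb & <-). unfold zsum.
  now rewrite (series_value_eq _ _ Ha), (series_value_eq _ _ Hb).
Qed.

Lemma zsummable_le f p l :
  (forall k, 0 <= f k <= p k) -> zsummable p l -> exists m, zsummable f m.
Proof.
  intros H (a & b & Ha & Hb & _).
  destruct (Rseries_CV_comp (fun n => f (Z.of_nat n)) (fun n => p (Z.of_nat n)))
    as [a' Ha']; [intros; apply H|now exists a|].
  destruct (Rseries_CV_comp (fun n => f (- Z.of_nat n - 1)%Z)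
              (fun n => p (- Z.of_nat n - 1)%Z))
    as [b' Hb']; [intros; apply H|now exists b|].
  exists (a' + b'), a', b'. auto.
Qed.

Lemma infinite_sum_plus u v a b :
  infinite_sum u a -> infinite_sum v b -> infinite_sum (fun n => u n + v n) (a + b).
Proof.
  intros Ha Hb. apply (Un_cv_ext (fun n => sum_f_R0 u n + sum_f_R0 v n)).
  - intros n. symmetry. apply sum_plus.
  - now apply CV_plus.
Qed.

Lemma zsummable_rsum {A} (F : A -> Z -> R) (L : A -> R) l :
  (forall x, In x l -> zsummable (F x) (L x)) ->
  zsummable (fun k => rsum (fun x => F x k) l) (rsum L l).
Proof.
  induction l as [|x l IH]; intros H; simpl.
  - assert (H0 : infinite_sum (fun _ => 0) 0).
    { apply (Un_cv_ext (fun _ => 0)); [|apply Un_cv_const].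
      intros n. induction n as [|n IHn]; simpl; [|rewrite <- IHn]; ring. }
    exists 0, 0. repeat split; trivial. ring.
  - destruct (H x) as (a & b & Ha & Hb & E); [now left|].
    destruct IH as (a' & b' & Ha' & Hb' & E'); [intros; apply H; now right|].
    exists (a + a'), (b + b'). split; [now apply infinite_sum_plus|].
    split; [now apply infinite_sum_plus|]. rewrite <- E, <- E'. ring.
Qed.

Lemma infinite_sum_term_le u l n :
  (forall k, 0 <= u k) -> infinite_sum u l -> u n <= l.
Proof.
  intros H Hl. apply Rle_trans with (sum_f_R0 u n).
  - destruct n as [|n]; simpl; [lra|].
    pose proof (cond_pos_sum u n H). lra.
  - now apply sum_incr.
Qed.

Lemma zsummable_term_le f l k : (forall k, 0 <= f k) -> zsummable f l -> f k <= l.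
Proof.
  intros H (a & b & Ha & Hb & <-).
  pose proof (infinite_sum_term_le _ _ 0 (fun n => H (Z.of_nat n)) Ha) as Ha0.
  pose proof (infinite_sum_term_le _ _ 0 (fun n => H (- Z.of_nat n - 1)%Z) Hb) as Hb0.
  pose proof (H (Z.of_nat 0)). pose proof (H (- Z.of_nat 0 - 1)%Z). simpl in *.
  destruct (Z_le_gt_dec 0 k) as [Hk|Hk].
  - pose proof (infinite_sum_term_le _ _ (Z.to_nat k) (fun n => H (Z.of_nat n)) Ha) as E.
    simpl in E. rewrite Z2Nat.id in E by trivial. lra.
  - pose proof (infinite_sum_term_le _ _ (Z.to_nat (- k - 1))
      (fun n => H (- Z.of_nat n - 1)%Z) Hb) as E.
    simpl in E. rewrite Z2Nat.id in E by lia.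
    replace (- (- k - 1) - 1)%Z with k in E by lia. lra.
Qed.

Lemma in_states m s : In s (states m) <-> (s <= m)%nat.
Proof. unfold states. rewrite in_seq. lia. Qed.

(** The minimum over the window is built by induction, each step adding the two end points. *)
Lemma lambda_uniform m p :
  lambda_pos m p ->
  exists lam, 0 < lam /\ forall k, (Z.abs k <= Z.of_nat m)%Z -> lam <= p k.
Proof.
  induction m as [|m IH]; intros H.
  - exists (p 0%Z). split; [apply H; lia|]. intros k Hk.
    replace k with 0%Z by lia. lra.
  - destruct IH as (lam & Hl & Hk); [intros k Hk; apply H; lia|].
    set (u := p (Z.of_nat (S m))). set (v := p (- Z.of_nat (S m))%Z).
    assert (0 < u) by (apply H; lia). assert (0 < v) by (apply H; lia).
    exists (Rmin lam (Rmin u v)). split; [repeat apply Rmin_glb_lt; trivial|].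
    intros k Hk'.
    assert (Z.abs k <= Z.of_nat m \/ k = Z.of_nat (S m) \/ k = - Z.of_nat (S m))%Z
      as [E|[->| ->]] by lia.
    + eapply Rle_trans; [apply Rmin_l|auto].
    + eapply Rle_trans; [apply Rmin_r|apply Rmin_l].
    + eapply Rle_trans; [apply Rmin_r|apply Rmin_r].
Qed.

(** * The transition kernel *)

Section Kernel.
Variables (Sm : nat) (pG : Z -> R).
Hypothesis law : is_Z_law pG.

Lemma kernel_summable s a s' :
  zsummable (fun g => if Z.eqb (clamp Sm (pre_state s a + g)) (Z.of_nat s')
                      then pG g else 0) (kernel Sm pG s a s').
Proof.
  destruct law as [Hpos H1].
  destruct (zsummable_le (fun g => if Z.eqb (clamp Sm (pre_state s a + g)) (Z.of_nat s')
     then pG g else 0) pG 1) as [m Hm]; trivial.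
  - intros k. specialize (Hpos k). destruct (Z.eqb _ _); lra.
  - unfold kernel. now rewrite (zsum_eq _ _ Hm).
Qed.

Lemma kernel_ge g s a s' :
  (if Z.eqb (clamp Sm (pre_state s a + g)) (Z.of_nat s') then pG g else 0)
  <= kernel Sm pG s a s'.
Proof.
  apply (zsummable_term_le _ _ g) with (2 := kernel_summable s a s').
  intros k. destruct (Z.eqb _ _); [apply law|lra].
Qed.

Lemma kernel_nonneg s a s' : 0 <= kernel Sm pG s a s'.
Proof.
  eapply Rle_trans; [|apply (kernel_ge 0)].
  destruct (Z.eqb _ _); [apply law|lra].
Qed.

(** Clamping sends each energy value to exactly one state, so the events defining the entries
    partition the law. *)
Lemma kernel_total s a : rsum (kernel Sm pG s a) (states Sm) = 1.
Proof.
  pose proof (zsummable_rsum _ _ (states Sm) (fun s' _ => kernel_summable s a s')) as H.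
  apply zsum_eq in H. rewrite <- H. clear H.
  apply zsum_eq. destruct law as [_ (u & v & Hu & Hv & E)].
  assert (Hpt : forall g, pG g = rsum (fun s' : nat =>
    if (clamp Sm (pre_state s a + g) =? Z.of_nat s')%Z then pG g else 0) (states Sm)).
  { intros g. set (c := clamp Sm (pre_state s a + g)).
    assert (Hc : (0 <= c <= Z.of_nat Sm)%Z) by (unfold c, clamp; lia).
    rewrite <- (rsum_pick Nat.eq_dec (fun _ => pG g) (states Sm) (Z.to_nat c)) at 1.
    - apply rsum_ext. intros s' _.
      destruct (Nat.eq_dec (Z.to_nat c) s'), (Z.eqb_spec c (Z.of_nat s')); trivial; lia.
    - apply seq_NoDup.
    - apply in_states. lia. }
  exists u, v. repeat split; trivial.
  - apply (Un_cv_ext (sum_f_R0 (fun n => pG (Z.of_nat n)))); trivial.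
    intros n. apply sum_eq. intros; apply Hpt.
  - apply (Un_cv_ext (sum_f_R0 (fun n => pG (- Z.of_nat n - 1)%Z))); trivial.
    intros n. apply sum_eq. intros; apply Hpt.
Qed.

(** The energy [s' - pre_state s a] leads straight to [s']; by admissibility both terms lie between
    0 and [Sm], so its modulus is at most [Sm]. *)
Lemma kernel_minor lam s a s' :
  (forall k, (Z.abs k <= Z.of_nat Sm)%Z -> lam <= pG k) ->
  admissible Sm s a -> (s' <= Sm)%nat -> lam <= kernel Sm pG s a s'.
Proof.
  intros Hlam Hadm Hs'. unfold admissible in Hadm.
  apply Rle_trans with (pG (Z.of_nat s' - pre_state s a)%Z).
  - apply Hlam. lia.
  - eapply Rle_trans; [|apply (kernel_ge (Z.of_nat s' - pre_state s a))].
    destruct (Z.eqb_spec (clamp Sm (pre_state s a + (Z.of_nat s' - pre_state s a)))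
      (Z.of_nat s')) as [|E]; [lra|]. exfalso. apply E. unfold clamp. lia.
Qed.

Variables (Lm Dm : nat) (mu : nat -> R).
Hypothesis init_ok : valid_init Sm mu.

Notation P := (pairs Sm Lm Dm).
Notation acts := (actions Lm Dm).

Lemma in_pairs s a : In (s, a) P <-> (s <= Sm)%nat /\ In a acts.
Proof. unfold pairs. rewrite in_prod_iff, in_states. tauto. Qed.

Lemma hists_in n h p : In h (hists Sm Lm Dm n) -> In p h -> In p P.
Proof.
  revert h. induction n as [|n IH]; intros h Hh Hp; cbn [hists] in Hh.
  - destruct Hh as [<-|[]]. contradiction.
  - apply in_flat_map in Hh. destruct Hh as (h' & Hh' & Hh).
    apply in_map_iff in Hh. destruct Hh as (q & <- & Hq).
    destruct Hp as [<-|Hp]; [trivial|eauto].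
Qed.

(** * State-action laws of an arbitrary policy *)

Section Policy.
Variable th : policy.
Hypothesis th_ok : valid_policy Sm Lm Dm th.

Lemma hprob_nonneg h : (forall p, In p h -> In p P) -> 0 <= hprob Sm pG mu th h.
Proof.
  induction h as [|[s a] h IH]; intros H; simpl; [lra|].
  assert (Hsa : In (s, a) P) by (apply H; now left).
  apply in_pairs in Hsa. destruct Hsa as [Hs Ha].
  apply Rmult_le_pos; [|apply IH; intros; apply H; now right].
  apply Rmult_le_pos.
  - destruct h as [|[s0 a0] h]; [now apply init_ok|apply kernel_nonneg].
  - now apply th_ok.
Qed.

Lemma marg_nonneg n s a : In (s, a) P -> 0 <= marg Sm Lm Dm pG mu th n s a.
Proof.
  intros H. apply rsum_nonneg. intros h Hh. apply hprob_nonneg.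
  intros p [<-|Hp]; [trivial|eapply hists_in; eauto].
Qed.

Lemma marg_support n s a :
  In (s, a) P -> ~ admissible Sm s a -> marg Sm Lm Dm pG mu th n s a = 0.
Proof.
  intros H Hadm. apply in_pairs in H. apply rsum_zero. intros h _. simpl.
  destruct (th_ok h s) as (_ & _ & H0); [tauto|]. rewrite H0 by tauto. ring.
Qed.

Lemma marg_init s : (s <= Sm)%nat -> rsum (marg Sm Lm Dm pG mu th 0 s) acts = mu s.
Proof.
  intros Hs.
  rewrite (rsum_ext _ (fun a => mu s * th [] s a)) by (intros; unfold marg; simpl; ring).
  rewrite rsum_scal. destruct (th_ok [] s Hs) as (_ & E & _). rewrite E. ring.
Qed.

(** The newest action sums out to one whatever the history, and the transition sees only the last
    pair. Hence one-step laws suffice even for history-dependent policies. *)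
Lemma marg_flow n s' : (s' <= Sm)%nat ->
  rsum (marg Sm Lm Dm pG mu th (S n) s') acts =
  rsum (fun p => marg Sm Lm Dm pG mu th n (fst p) (snd p) *
                 kernel Sm pG (fst p) (snd p) s') P.
Proof.
  intros Hs. unfold marg at 1. rewrite rsum_swap.
  cbn [hists]. rewrite rsum_flat_map.
  unfold marg. rewrite (rsum_ext (fun p : nat * action => _ * _)
    (fun p => rsum (fun h => hprob Sm pG mu th (p :: h) * kernel Sm pG (fst p) (snd p) s')
                   (hists Sm Lm Dm n)))
    by (intros [s a] _; now rewrite rsum_scal_r).
  rewrite rsum_swap. apply rsum_ext. intros h _.
  rewrite rsum_map. apply rsum_ext. intros [s a] _.
  change (rsum (fun b => kernel Sm pG s a s' * th ((s, a) :: h) s' b *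
     hprob Sm pG mu th ((s, a) :: h)) acts =
     hprob Sm pG mu th ((s, a) :: h) * kernel Sm pG s a s').
  rewrite rsum_scal_r, rsum_scal.
  destruct (th_ok ((s, a) :: h) s' Hs) as (_ & E & _). rewrite E. ring.
Qed.

Lemma marg_total n :
  rsum (fun p => marg Sm Lm Dm pG mu th n (fst p) (snd p)) P = 1.
Proof.
  induction n as [|n IH]; unfold pairs at 1; rewrite rsum_list_prod; cbn [fst snd].
  - rewrite (rsum_ext _ mu); [apply init_ok|].
    intros s Hs. apply marg_init. now apply in_states.
  - rewrite (rsum_ext _ (fun s' => rsum (fun p => marg Sm Lm Dm pG mu th n (fst p) (snd p) *
                 kernel Sm pG (fst p) (snd p) s') P)).
    + rewrite rsum_swap, <- IH. apply rsum_ext. intros p _.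
      rewrite rsum_scal, kernel_total. ring.
    + intros s' Hs'. apply marg_flow. now apply in_states.
Qed.

Lemma marg_unit n s a : In (s, a) P -> 0 <= marg Sm Lm Dm pG mu th n s a <= 1.
Proof.
  intros H. split; [now apply marg_nonneg|].
  rewrite <- (marg_total n).
  apply (rsum_term_le (fun p => marg Sm Lm Dm pG mu th n (fst p) (snd p)) P (s, a)); trivial.
  intros [s0 a0] H0. now apply marg_nonneg.
Qed.

Definition reward_at (r : nat * action -> R) (n : nat) : R :=
  rsum (fun p => marg Sm Lm Dm pG mu th n (fst p) (snd p) * r p) P.

Definition potential (h : nat -> R) (n : nat) : R :=
  rsum (fun p => marg Sm Lm Dm pG mu th n (fst p) (snd p) * h (fst p)) P.

Lemma potential_next h n :
  potential h (S n) =
  rsum (fun p => marg Sm Lm Dm pG mu th n (fst p) (snd p) *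
     rsum (fun s' => kernel Sm pG (fst p) (snd p) s' * h s') (states Sm)) P.
Proof.
  unfold potential, pairs at 1. rewrite rsum_list_prod. cbn [fst snd].
  rewrite (rsum_ext _ (fun s' => rsum (fun p => marg Sm Lm Dm pG mu th n (fst p) (snd p) *
                 kernel Sm pG (fst p) (snd p) s' * h s') P)).
  - rewrite rsum_swap. apply rsum_ext. intros p _.
    rewrite <- rsum_scal. apply rsum_ext. intros s' _. ring.
  - intros s' Hs'. rewrite !rsum_scal_r. f_equal. apply marg_flow. now apply in_states.
Qed.

Lemma potential_bounded h n :
  Rabs (potential h n) <= rsum (fun p => Rabs (h (fst p))) P.
Proof.
  eapply Rle_trans; [apply rsum_abs|]. apply rsum_le. intros [s a] Hp. simpl.
  rewrite Rabs_mult. pose proof (marg_unit n s a Hp).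
  rewrite Rabs_pos_eq by lra. pose proof (Rabs_pos (h s)). nra.
Qed.

(** The inequality is integrated against the law at time [n]; inadmissible pairs carry no mass, so
    it is required only at admissible ones. *)
Lemma reward_le_of_bellman r h g n :
  (forall s a, In (s, a) P -> admissible Sm s a ->
     r (s, a) + rsum (fun s' => kernel Sm pG s a s' * h s') (states Sm) <= g + h s) ->
  reward_at r n <= g + potential h n - potential h (S n).
Proof.
  intros H. rewrite potential_next. unfold reward_at, potential.
  rewrite <- (Rmult_1_r g), <- (marg_total n), <- rsum_scal, <- rsum_plus, <- rsum_minus.
  apply rsum_le. intros [s a] Hp. cbn [fst snd].
  destruct (classic (admissible Sm s a)) as [Ha|Ha].
  - pose proof (marg_nonneg n s a Hp) as H0. specialize (H s a Hp Ha).
    apply (Rmult_le_compat_l _ _ _ H0) in H. lra.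
  - rewrite marg_support by trivial. lra.
Qed.

End Policy.

(** * Convergence under a stationary policy *)

Section Stationary.
Variable Ps : spolicy.
Hypothesis Ps_ok : valid_spolicy Sm Lm Dm Ps.

Lemma of_stat_valid : valid_policy Sm Lm Dm (of_stat Ps).
Proof. intros h s Hs. now apply Ps_ok. Qed.

Notation m := (marg Sm Lm Dm pG mu (of_stat Ps)).
Notation ms n s := (rsum (m n s) acts).

(** The action factor does not depend on the history and comes out of the sum; summing over actions
    identifies the remaining constant. *)
Lemma marg_stat n s a : (s <= Sm)%nat -> m n s a = ms n s * Ps s a.
Proof.
  intros Hs. set (c := rsum (fun h =>
     match h with [] => mu s | (s0, a0) :: _ => kernel Sm pG s0 a0 s end *
     hprob Sm pG mu (of_stat Ps) h) (hists Sm Lm Dm n)).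
  assert (E : forall b, m n s b = c * Ps s b).
  { intros b. unfold marg, c. rewrite <- rsum_scal_r. apply rsum_ext.
    intros h _. simpl. unfold of_stat. ring. }
  rewrite (rsum_ext (m n s) (fun b => c * Ps s b)) by (intros; apply E).
  rewrite rsum_scal. destruct (Ps_ok s Hs) as (_ & E1 & _). rewrite E1, E. ring.
Qed.

(** Because the law factors through [Ps], equality averaged over the actions of each state is
    enough. *)
Lemma reward_eq_of_bellman r h g n :
  (forall s, (s <= Sm)%nat ->
     rsum (fun a => Ps s a * (r (s, a) +
       rsum (fun s' => kernel Sm pG s a s' * h s') (states Sm))) acts = g + h s) ->
  reward_at (of_stat Ps) r n =
    g + potential (of_stat Ps) h n - potential (of_stat Ps) h (S n).
Proof.
  intros H. rewrite potential_next by apply of_stat_valid.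
  unfold reward_at, potential.
  rewrite <- (Rmult_1_r g), <- (marg_total _ of_stat_valid n), <- rsum_scal, <- rsum_plus.
  apply Rminus_diag_uniq. rewrite <- !rsum_minus.
  unfold pairs. rewrite rsum_list_prod. apply rsum_zero. intros s Hs.
  apply in_states in Hs. cbn [fst snd].
  rewrite (rsum_ext _ (fun a => ms n s * (Ps s a * (r (s, a) +
       rsum (fun s' => kernel Sm pG s a s' * h s') (states Sm))
       - (g + h s) * Ps s a))).
  - rewrite rsum_scal, rsum_minus, H, rsum_scal by trivial.
    destruct (Ps_ok s Hs) as (_ & E & _). rewrite E. ring.
  - intros a _. rewrite (marg_stat n s a) by trivial. ring.
Qed.

Variables (lam : R) (pi : nat -> R).
Hypothesis lam_pos : 0 < lam.
Hypothesis lam_le : forall k, (Z.abs k <= Z.of_nat Sm)%Z -> lam <= pG k.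
Hypothesis pi_total : rsum pi (states Sm) = 1.
Hypothesis pi_flow : forall s', (s' <= Sm)%nat ->
  rsum (fun s => rsum (fun a => pi s * Ps s a * kernel Sm pG s a s') acts) (states Sm) = pi s'.

Definition deviation n : R := rsum (fun s => Rabs (ms n s - pi s)) (states Sm).

(* Doeblin: the deviation has total mass 0, so [lam] may be subtracted from the kernel. *)
Lemma deviation_contracts n :
  deviation (S n) <= (1 - INR (S Sm) * lam) * deviation n.
Proof.
  set (e := fun s => ms n s - pi s).
  assert (He : rsum e (states Sm) = 0).
  { unfold e. rewrite rsum_minus, pi_total.
    pose proof (marg_total _ of_stat_valid n) as H. unfold pairs in H.
    rewrite rsum_list_prod in H.
    change (rsum (fun s => ms n s) (states Sm) = 1) in H. rewrite H. ring. }
  assert (Hstep : forall s', (s' <= Sm)%nat -> ms (S n) s' - pi s' =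
     rsum (fun s => e s * rsum (fun a => Ps s a * (kernel Sm pG s a s' - lam)) acts) (states Sm)).
  { intros s' Hs'. rewrite (marg_flow _ of_stat_valid), <- pi_flow by trivial.
    unfold pairs. rewrite rsum_list_prod, <- rsum_minus. cbn [fst snd].
    transitivity (rsum (fun s => e s * rsum (fun a => Ps s a * (kernel Sm pG s a s' - lam)) acts
                                 + e s * lam) (states Sm));
      [|rewrite rsum_plus, rsum_scal_r, He; ring].
    apply rsum_ext. intros s Hs. apply in_states in Hs.
    rewrite <- rsum_minus.
    rewrite (rsum_ext _ (fun a => e s * (Ps s a * (kernel Sm pG s a s' - lam)) + e s * lam * Ps s a)).
    - rewrite rsum_plus, !rsum_scal. destruct (Ps_ok s Hs) as (_ & E & _). rewrite E. ring.
    - intros a _. rewrite (marg_stat n s a) by trivial. unfold e. ring. }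
  unfold deviation at 1.
  rewrite (rsum_ext _ (fun s' => Rabs (rsum (fun s => e s *
     rsum (fun a => Ps s a * (kernel Sm pG s a s' - lam)) acts) (states Sm))))
    by (intros s' Hs'; rewrite Hstep; [trivial|now apply in_states]).
  apply Rle_trans with (rsum (fun s' => rsum (fun s => Rabs (e s) *
     rsum (fun a => Ps s a * (kernel Sm pG s a s' - lam)) acts) (states Sm)) (states Sm)).
  - apply rsum_le. intros s' Hs'. apply in_states in Hs'.
    eapply Rle_trans; [apply rsum_abs|]. apply rsum_le. intros s Hs. apply in_states in Hs.
    rewrite Rabs_mult. apply Rmult_le_compat_l; [apply Rabs_pos|].
    rewrite Rabs_pos_eq; [lra|]. apply rsum_nonneg. intros a Ha.
    destruct (Ps_ok s Hs) as (H0 & _ & Hz).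
    destruct (classic (admissible Sm s a)) as [Hadm|Hadm].
    + pose proof (kernel_minor lam s a s' lam_le Hadm Hs'). specialize (H0 a Ha).
      apply Rmult_le_pos; lra.
    + rewrite Hz by trivial. lra.
  (* Summed over targets, each row of the reduced kernel has mass [1 - INR (S Sm) * lam], the
     contraction factor. *)
  - rewrite rsum_swap. unfold deviation. rewrite <- rsum_scal. apply Req_le.
    apply rsum_ext. intros s Hs. apply in_states in Hs.
    rewrite rsum_scal, rsum_swap. rewrite (rsum_ext _ (fun a => Ps s a * (1 - INR (S Sm) * lam))).
    + rewrite rsum_scal_r. destruct (Ps_ok s Hs) as (_ & E & _). rewrite E.
      unfold e. ring.
    + intros a _. rewrite rsum_scal, rsum_minus, kernel_total, rsum_const.
      unfold states. rewrite length_seq. ring.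
Qed.

Lemma marg_stat_cv s a : (s <= Sm)%nat -> Un_cv (fun n => m n s a) (pi s * Ps s a).
Proof.
  intros Hs. set (q := 1 - INR (S Sm) * lam).
  (* One admissible row of mass 1 with all entries at least [lam] shows that the contraction factor
     is nonnegative. *)
  assert (Hadm : admissible Sm 0 (0%nat, 0%nat)) by (unfold admissible, pre_state; simpl; lia).
  assert (Hq : 0 <= q < 1).
  { unfold q. pose proof (lt_0_INR (S Sm) (Nat.lt_0_succ _)). split; [|nra].
    rewrite <- (kernel_total 0 (0%nat, 0%nat)).
    replace (INR (S Sm) * lam) with (rsum (fun _ : nat => lam) (states Sm))
      by (rewrite rsum_const; unfold states; now rewrite length_seq).
    rewrite <- rsum_minus. apply rsum_nonneg. intros s' Hs'. apply in_states in Hs'.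
    pose proof (kernel_minor lam 0 (0%nat, 0%nat) s' lam_le Hadm Hs'). lra. }
  assert (Hpow : forall n, deviation n <= deviation 0 * q ^ n).
  { induction n as [|n IH]; simpl; [lra|].
    pose proof (deviation_contracts n). fold q in H. nra. }
  assert (Hcv : Un_cv (fun n => deviation 0 * q ^ n) 0).
  { replace 0 with (deviation 0 * 0) by ring. apply CV_mult; [apply Un_cv_const|].
    intros eps He. destruct (pow_lt_1_zero q) with (y := eps) as [N HN]; trivial.
    - rewrite Rabs_pos_eq; tauto.
    - exists N. intros n Hn. unfold Rdist. rewrite Rminus_0_r. now apply HN. }
  apply (Un_cv_ext (fun n => ms n s * Ps s a)); [intros n; symmetry; now apply marg_stat|].
  apply CV_mult; [|apply Un_cv_const].
  apply Un_cv_dominated with (2 := Hcv). intros n.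
  eapply Rle_trans; [|apply Hpow].
  apply (rsum_term_le (fun s => Rabs (ms n s - pi s))).
  - intros; apply Rabs_pos.
  - now apply in_states.
Qed.

End Stationary.
End Kernel.

(** * Average payoffs *)

(** Justifies the [epsilon] in [limsup]: a witness is the supremum of the levels exceeded infinitely
    often, a set that boundedness makes nonempty and bounded above. *)
Lemma limsup_spec u B : (forall n, Rabs (u n) <= B) -> is_limsup u (limsup u).
Proof.
  intros HB. unfold limsup. apply epsilon_spec.
  set (E := fun x => forall N, exists n, (N <= n)%nat /\ x < u n).
  destruct (completeness E) as [l [Hub Hlub]].
  - exists B. intros x Hx. destruct (Hx 0%nat) as (n & _ & Hn).
    pose proof (Rabs_le_between _ _ (HB n)). lra.
  - exists (- B - 1). intros N. exists N. split; [lia|].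
    pose proof (Rabs_le_between _ _ (HB N)). lra.
  - exists l. split.
    + intros eps He. apply NNPP. intros Hno.
      assert (HE : E (l + eps / 2)).
      { intros N. apply NNPP. intros HN. apply Hno. exists N. intros n Hn.
        destruct (Rlt_le_dec (u n) (l + eps)); trivial.
        exfalso. apply HN. exists n. split; trivial. lra. }
      specialize (Hub _ HE). lra.
    + intros eps He N. apply NNPP. intros Hno.
      assert (is_upper_bound E (l - eps)) as H.
      { intros x Hx. destruct (Rle_dec x (l - eps)) as [|Hgt]; trivial.
        exfalso. apply Hno. destruct (Hx N) as (n & Hn & Hlt).
        exists n. split; trivial. lra. }
      specialize (Hlub _ H). lra.
Qed.

Lemma limsup_le u v l B :
  (forall n, Rabs (u n) <= B) -> (forall n, u n <= v n) -> Un_cv v l -> limsup u <= l.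
Proof.
  intros HB Hle Hv. destruct (limsup_spec u B HB) as [_ H].
  apply le_epsilon. intros eps He.
  destruct (Hv (eps / 2)) as [N HN]; [lra|].
  destruct (H (eps / 2)) with (N := N) as (n & Hn & Hlt); [lra|].
  specialize (HN n Hn). apply Rabs_def2 in HN. specialize (Hle n). lra.
Qed.

Lemma limsup_ge u v l B :
  (forall n, Rabs (u n) <= B) -> (forall n, v n <= u n) -> Un_cv v l -> l <= limsup u.
Proof.
  intros HB Hle Hv. destruct (limsup_spec u B HB) as [H _].
  apply le_epsilon. intros eps He.
  destruct (Hv (eps / 2)) as [N HN]; [lra|].
  destruct (H (eps / 2)) as [N' HN']; [lra|].
  specialize (HN (N + N')%nat ltac:(lia)). specialize (HN' (N + N')%nat ltac:(lia)).
  apply Rabs_def2 in HN. specialize (Hle (N + N')%nat). lra.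
Qed.

Definition average (u : nat -> R) (T : nat) : R :=
  / INR (S T) * rsum u (seq 0 (S T)).

Lemma rsum_seq_S u n : rsum u (seq 0 (S n)) = rsum u (seq 0 n) + u n.
Proof. rewrite seq_S, rsum_app. simpl. ring. Qed.

Lemma average_le u v T : (forall n, u n <= v n) -> average u T <= average v T.
Proof.
  intros H. apply Rmult_le_compat_l.
  - apply Rlt_le, Rinv_0_lt_compat, lt_0_INR. lia.
  - apply rsum_le. intros; apply H.
Qed.

Lemma average_const c T : average (fun _ => c) T = c.
Proof.
  unfold average. rewrite rsum_const, length_seq. field.
  apply not_0_INR. lia.
Qed.

Lemma average_bounded u B T : (forall n, Rabs (u n) <= B) -> Rabs (average u T) <= B.
Proof.
  intros H. apply Rabs_le. split.
  - rewrite <- (average_const (- B) T). apply average_le.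
    intros n. apply (Rabs_le_between _ _ (H n)).
  - rewrite <- (average_const B T). apply average_le.
    intros n. apply (Rabs_le_between _ _ (H n)).
Qed.

Lemma average_cv u l : Un_cv u l -> Un_cv (average u) l.
Proof.
  intros H. apply (Un_cv_ext (fun n => sum_f_R0 u (pred (S n)) / INR (S n))).
  - intros n. unfold average, Rdiv. rewrite Rmult_comm. f_equal.
    simpl pred. induction n as [|n IH]; [simpl; ring|].
    now rewrite rsum_seq_S, <- IH.
  - apply (Un_cv_subseq (fun n => sum_f_R0 u (pred n) / INR n)); [lia|].
    now apply Cesaro_1.
Qed.

(** The potential differences leave a boundary term of size at most [2 * B], killed by the division
    by time; the error dies by Cesaro's theorem. *)
Lemma average_telescope_cv g (phi err : nat -> R) B :
  (forall n, Rabs (phi n) <= B) -> Un_cv err 0 ->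
  Un_cv (average (fun n => g + phi n - phi (S n) + err n)) g.
Proof.
  intros HB Herr.
  apply (Un_cv_ext (fun T => g + (phi 0%nat - phi (S T)) * / INR (S T) + average err T)).
  - intros T. rewrite <- (average_const g T) at 1. unfold average.
    rewrite rsum_plus, rsum_minus, rsum_plus.
    assert (E : rsum phi (seq 0 (S T)) - rsum (fun n => phi (S n)) (seq 0 (S T))
                = phi 0%nat - phi (S T)).
    { induction T as [|T IH]; [simpl; ring|].
      rewrite !(rsum_seq_S _ (S T)). lra. }
    rewrite <- E. ring.
  - replace g with (g + 0 + 0) at 1 by ring.
    apply CV_plus; [apply CV_plus; [apply Un_cv_const|]|now apply average_cv].
    apply Un_cv_dominated with (fun T => 2 * B * / INR (S T)).
    + intros T. assert (Hp : 0 < / INR (S T)) by (apply Rinv_0_lt_compat, lt_0_INR; lia).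
      rewrite Rminus_0_r, Rabs_mult, (Rabs_pos_eq (/ _)) by lra.
      apply Rmult_le_compat_r; [lra|]. apply Rabs_le.
      pose proof (Rabs_le_between _ _ (HB 0%nat)).
      pose proof (Rabs_le_between _ _ (HB (S T))). lra.
    + replace 0 with (2 * B * 0) by ring.
      apply CV_mult; [apply Un_cv_const|apply inv_INR_cv].
Qed.

(** Clipping the argument turns continuity relative to [0,1] into continuity on the line, so
    sequential limits need no side conditions. *)
Lemma weight_continuous f :
  cont_on_01 f -> continuity (fun y => f (clip 0 1 y)).
Proof.
  intros Hf y eps He.
  destruct (Hf (clip 0 1 y) ltac:(apply clip_bounds; lra) eps He) as (d & Hd & H).
  exists d. split; trivial. intros z [_ Hz]. apply H. split.
  - apply clip_bounds; lra.
  - eapply Rle_lt_trans; [apply clip_lipschitz|exact Hz].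
Qed.

Lemma weight_bounded f :
  cont_on_01 f -> exists W, 0 <= W /\ forall y, Rabs (f (clip 0 1 y)) <= W.
Proof.
  intros Hf.
  destruct (continuity_ab_maj (fun y => Rabs (f (clip 0 1 y))) 0 1) as (y0 & Hy0 & _).
  - lra.
  - intros c _. apply (continuity_pt_comp _ Rabs); [now apply weight_continuous|].
    apply Rcontinuity_abs.
  - exists (Rabs (f (clip 0 1 y0))). split; [apply Rabs_pos|]. intros y.
    assert (Hy : 0 <= clip 0 1 y <= 1) by (apply clip_bounds; lra).
    specialize (Hy0 _ Hy). now rewrite (clip_id 0 1 (clip 0 1 y)) in Hy0.
Qed.

(** * Admissible actions, pairs and profiles *)

Definition admissibleb (m s : nat) (a : action) : bool :=
  (Z.leb 0 (pre_state s a) && Z.leb (pre_state s a) (Z.of_nat m))%bool.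

Lemma admissibleb_spec m s a : admissibleb m s a = true <-> admissible m s a.
Proof.
  unfold admissibleb, admissible. rewrite Bool.andb_true_iff, !Z.leb_le. tauto.
Qed.

Definition pair_eq_dec (p q : nat * action) : {p = q} + {p <> q}.
Proof. repeat decide equality. Defined.

Lemma in_profs G k prof j :
  In prof (profs G k) -> (j < k)%nat -> In (nth j prof dflt) (pairs_of G j).
Proof.
  assert (Hl : forall m p, In p (profs G m) -> length p = m).
  { induction m as [|m IHm]; intros p Hp; cbn [profs] in Hp.
    - destruct Hp as [<-|[]]. reflexivity.
    - apply in_flat_map in Hp. destruct Hp as (q & Hq & Hp).
      apply in_map_iff in Hp. destruct Hp as (y & <- & _).
      rewrite length_app, (IHm q Hq). simpl. lia. }
  revert prof. induction k as [|k IH]; intros prof Hp Hj; [lia|].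
  cbn [profs] in Hp. apply in_flat_map in Hp. destruct Hp as (q & Hq & Hp).
  apply in_map_iff in Hp. destruct Hp as (y & <- & Hy).
  pose proof (Hl k q Hq). destruct (Nat.eq_dec j k) as [->|Hne].
  - rewrite app_nth2 by lia. replace (k - length q)%nat with 0%nat by lia. exact Hy.
  - rewrite app_nth1 by lia. apply IH; [trivial|lia].
Qed.

Lemma NoDup_list_prod {A B} (l : list A) (m : list B) :
  NoDup l -> NoDup m -> NoDup (list_prod l m).
Proof.
  intros Hl Hm. induction Hl as [|x l Hx Hl IH]; simpl; [constructor|].
  apply NoDup_app; trivial.
  - apply FinFun.Injective_map_NoDup; trivial. intros y z E. now injection E.
  - intros [y z] Hy Hyz. apply in_map_iff in Hy. destruct Hy as (w & E & _).
    injection E as <- _. apply in_prod_iff in Hyz. tauto.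
Qed.

Lemma pairs_NoDup m l d : NoDup (pairs m l d).
Proof. repeat apply NoDup_list_prod; apply seq_NoDup. Qed.

(** * Comparing stage payoffs with limit rewards *)

Section Game.

Variable G : game.

Definition opponents (i : nat) : list nat :=
  filter (fun j => negb (Nat.eqb j i)) (seq 0 (nP G)).

Lemma in_opponents i j : In j (opponents i) -> (j < nP G)%nat.
Proof. intros H. apply filter_In in H. destruct H as [H _]. apply in_seq in H. lia. Qed.

(** Only admissible actions are governed by the fixed point; coordinates of [x] at other actions are
    arbitrary and are replaced by 0. *)
Definition policy_of (x : var action -> R) : nat -> spolicy := fun j s a =>
  if admissibleb (Smax G j) s a then x (VPsi j s a) else 0.

Definition limit_weight (i : nat) (x : var action -> R) (prof : list (nat * action)) : R :=
  wf G i (clip 0 1 (rprod (fun j => x (VPi j (fst (nth j prof dflt))) *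
    policy_of x j (fst (nth j prof dflt)) (snd (nth j prof dflt))) (opponents i))).

(** Profiles are grouped by player i's own pair. Only the limit laws of the opponents enter, so
    player i's law later acts linearly. *)
Definition limit_reward (i : nat) (x : var action -> R) (s : nat) (a : action) : R :=
  rsum (fun prof => if pair_eq_dec (nth i prof dflt) (s, a)
                    then limit_weight i x prof * vf G i (U G i (map snd prof)) else 0)
       (profs G (nP G)).

Lemma limit_weight_cv i X x prof : cont_on_01 (wf G i) ->
  (forall w, Un_cv (fun n => X n w) (x w)) ->
  Un_cv (fun n => limit_weight i (X n) prof) (limit_weight i x prof).
Proof.
  intros Hw HX. apply (continuity_seq (fun y => wf G i (clip 0 1 y)));
    [now apply weight_continuous|].
  apply rprod_cv. intros j _. apply CV_mult; [apply HX|].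
  unfold policy_of. destruct (admissibleb _ _ _); [apply HX|apply Un_cv_const].
Qed.

Lemma limit_reward_cv i X x s a : cont_on_01 (wf G i) ->
  (forall w, Un_cv (fun n => X n w) (x w)) ->
  Un_cv (fun n => limit_reward i (X n) s a) (limit_reward i x s a).
Proof.
  intros Hw HX. apply rsum_cv. intros prof _.
  destruct (pair_eq_dec _ _); [|apply Un_cv_const].
  apply CV_mult; [now apply limit_weight_cv|apply Un_cv_const].
Qed.

Lemma limit_reward_bounded i : cont_on_01 (wf G i) ->
  exists B, 0 <= B /\ forall x s a, Rabs (limit_reward i x s a) <= B.
Proof.
  intros Hw. destruct (weight_bounded _ Hw) as (W & HW & H).
  exists (rsum (fun prof => W * Rabs (vf G i (U G i (map snd prof)))) (profs G (nP G))).
  split.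
  - apply rsum_nonneg. intros prof _. apply Rmult_le_pos; [trivial|apply Rabs_pos].
  - intros x s a. eapply Rle_trans; [apply rsum_abs|]. apply rsum_le. intros prof _.
    pose proof (Rabs_pos (vf G i (U G i (map snd prof)))).
    destruct (pair_eq_dec _ _).
    + rewrite Rabs_mult. apply Rmult_le_compat_r; [trivial|apply H].
    + rewrite Rabs_R0. now apply Rmult_le_pos.
Qed.

Hypothesis G_ok : forall i, (i < nP G)%nat ->
  is_Z_law (lawG G i) /\ lambda_pos (Smax G i) (lawG G i) /\
  cont_on_01 (wf G i) /\ valid_init (Smax G i) (init G i).

Variable Ps : nat -> spolicy.
Hypothesis Ps_ok : forall j, (j < nP G)%nat ->
  valid_spolicy (Smax G j) (Lmax G j) (Dmax G j) (Ps j).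
Variables (x : var action -> R).
Hypothesis marg_cv : forall j s a, (j < nP G)%nat -> (s <= Smax G j)%nat ->
  Un_cv (fun n => margG G j (of_stat (Ps j)) n s a) (x (VPi j s) * policy_of x j s a).

Variable i : nat.
Hypothesis i_lt : (i < nP G)%nat.
Variable th : policy.
Hypothesis th_ok : valid_policy (Smax G i) (Lmax G i) (Dmax G i) th.

Lemma margG_unit j t n s a : (j < nP G)%nat ->
  valid_policy (Smax G j) (Lmax G j) (Dmax G j) t -> In (s, a) (pairs_of G j) ->
  0 <= margG G j t n s a <= 1.
Proof. intros Hj Ht H. destruct (G_ok j Hj) as (? & ? & ? & ?). now apply marg_unit. Qed.

Definition stage_weight (n : nat) (prof : list (nat * action)) : R :=
  wf G i (clip 0 1 (rprod (fun j => margG G j (of_stat (Ps j)) n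
     (fst (nth j prof dflt)) (snd (nth j prof dflt))) (opponents i))).

Lemma stage_eq n : stage G i th Ps n =
  rsum (fun prof =>
    margG G i th n (fst (nth i prof dflt)) (snd (nth i prof dflt)) *
    (stage_weight n prof * vf G i (U G i (map snd prof)))) (profs G (nP G)).
Proof.
  apply rsum_ext. intros prof Hp. rewrite Rmult_assoc. do 2 f_equal.
  unfold stage_weight. rewrite clip_id; [reflexivity|].
  apply rprod_unit. intros j Hj. apply in_opponents in Hj.
  apply margG_unit; trivial; [now apply of_stat_valid, Ps_ok|].
  rewrite <- surjective_pairing. now apply (in_profs G (nP G)).
Qed.

(** Each profile contains exactly one pair of player i, so exchanging the sums undoes the grouping
    in [limit_reward]. *)
Lemma reward_at_limit_reward n :
  reward_at (Smax G i) (lawG G i) (Lmax G i) (Dmax G i) (init G i) th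
    (fun p => limit_reward i x (fst p) (snd p)) n =
  rsum (fun prof =>
    margG G i th n (fst (nth i prof dflt)) (snd (nth i prof dflt)) *
    (limit_weight i x prof * vf G i (U G i (map snd prof)))) (profs G (nP G)).
Proof.
  unfold reward_at, limit_reward.
  rewrite (rsum_ext _ (fun p => rsum (fun prof =>
    if pair_eq_dec (nth i prof dflt) p then
      margG G i th n (fst p) (snd p) *
      (limit_weight i x prof * vf G i (U G i (map snd prof))) else 0) (profs G (nP G)))).
  - rewrite rsum_swap. apply rsum_ext. intros prof Hp.
    apply (rsum_pick pair_eq_dec (fun p => margG G i th n (fst p) (snd p) *
      (limit_weight i x prof * vf G i (U G i (map snd prof))))).
    + apply pairs_NoDup.
    + now apply (in_profs G (nP G)).
  - intros [s a] _. rewrite <- rsum_scal. apply rsum_ext. intros prof _. cbn [fst snd].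
    destruct (pair_eq_dec _ _); [reflexivity|ring].
Qed.

(** Player i's probabilities are at most 1, so the error is bounded by weight differences free of
    [th]; these vanish since the opponents' laws converge and [wf] is continuous. *)
Lemma stage_error_cv :
  Un_cv (fun n => stage G i th Ps n -
    reward_at (Smax G i) (lawG G i) (Lmax G i) (Dmax G i) (init G i) th
      (fun p => limit_reward i x (fst p) (snd p)) n) 0.
Proof.
  destruct (G_ok i i_lt) as (_ & _ & Hw & _).
  apply Un_cv_dominated with (fun n => rsum (fun prof =>
    Rabs (stage_weight n prof - limit_weight i x prof) *
    Rabs (vf G i (U G i (map snd prof)))) (profs G (nP G))).
  - intros n. rewrite Rminus_0_r, stage_eq, reward_at_limit_reward, <- rsum_minus.
    eapply Rle_trans; [apply rsum_abs|]. apply rsum_le. intros prof Hp.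
    assert (Hm := margG_unit i th n (fst (nth i prof dflt)) (snd (nth i prof dflt)) i_lt th_ok).
    rewrite <- surjective_pairing in Hm. specialize (Hm (in_profs _ _ _ _ Hp i_lt)).
    rewrite <- Rmult_minus_distr_l, <- Rmult_minus_distr_r, !Rabs_mult, Rabs_pos_eq by lra.
    rewrite <- (Rmult_1_l (Rabs (_ - _) * _)) at 2. apply Rmult_le_compat_r; [|lra].
    apply Rmult_le_pos; apply Rabs_pos.
  - rewrite <- (rsum_zero (fun _ : list (nat * action) => 0) (profs G (nP G))) by trivial.
    apply rsum_cv. intros prof Hp.
    replace 0 with (0 * Rabs (vf G i (U G i (map snd prof)))) by ring.
    apply CV_mult; [|apply Un_cv_const].
    rewrite <- Rabs_R0. apply (cv_cvabs (fun n => stage_weight n prof - limit_weight i x prof)).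
    rewrite <- (Rminus_diag (limit_weight i x prof)).
    apply CV_minus; [|apply Un_cv_const].
    apply (continuity_seq (fun y => wf G i (clip 0 1 y))); [now apply weight_continuous|].
    apply rprod_cv. intros j Hj. apply in_opponents in Hj. apply marg_cv; trivial.
    pose proof (in_profs _ _ _ _ Hp Hj) as H. destruct (nth j prof dflt) as [s a].
    apply in_pairs in H. apply H.
Qed.

Lemma stage_bounded : exists B, forall n, Rabs (stage G i th Ps n) <= B.
Proof.
  destruct (G_ok i i_lt) as (_ & _ & Hw & _).
  destruct (weight_bounded _ Hw) as (W & HW & H).
  exists (rsum (fun prof => W * Rabs (vf G i (U G i (map snd prof)))) (profs G (nP G))).
  intros n. rewrite stage_eq. eapply Rle_trans; [apply rsum_abs|].
  apply rsum_le. intros prof Hp.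
  assert (Hm := margG_unit i th n (fst (nth i prof dflt)) (snd (nth i prof dflt)) i_lt th_ok).
  rewrite <- surjective_pairing in Hm. specialize (Hm (in_profs _ _ _ _ Hp i_lt)).
  rewrite !Rabs_mult, Rabs_pos_eq by lra.
  rewrite <- (Rmult_1_l (W * _)). apply Rmult_le_compat; try lra.
  - apply Rmult_le_pos; apply Rabs_pos.
  - apply Rmult_le_compat_r; [apply Rabs_pos|apply H].
Qed.

Variables (h : nat -> R) (g : R).

Notation rho := (reward_at (Smax G i) (lawG G i) (Lmax G i) (Dmax G i) (init G i) th
      (fun p => limit_reward i x (fst p) (snd p))).
Notation phi := (potential (Smax G i) (lawG G i) (Lmax G i) (Dmax G i) (init G i) th h).

(** Stage payoff is limit reward plus a vanishing error, so either comparison with a telescoping sum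
    carries over to the averages, whose comparison sequence tends to [g]. *)
Lemma average_stage_bounds :
  ((forall n, rho n <= g + phi n - phi (S n)) -> Vpay G i th Ps <= g) /\
  ((forall n, rho n = g + phi n - phi (S n)) -> g <= Vpay G i th Ps).
Proof.
  destruct (G_ok i i_lt) as (Hlaw & _ & _ & Hinit).
  destruct stage_bounded as [B HB].
  assert (Hcv : Un_cv (average (fun n => g + phi n - phi (S n) + (stage G i th Ps n - rho n))) g).
  { apply average_telescope_cv with (2 := stage_error_cv)
      (B := rsum (fun p => Rabs (h (fst p))) (pairs_of G i)).
    intros n. now apply potential_bounded. }
  split; intros H; [eapply limsup_le with (3 := Hcv)|eapply limsup_ge with (3 := Hcv)];
    try (intros T; apply average_bounded, HB);
    intros T; apply average_le; intros n; specialize (H n); lra.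
Qed.

End Game.

(** * Existence of the equilibrium *)

Theorem theorem1 (G : game) :
  (forall i, (i < nP G)%nat ->
     is_Z_law (lawG G i) /\ lambda_pos (Smax G i) (lawG G i) /\
     cont_on_01 (wf G i) /\ valid_init (Smax G i) (init G i)) ->
  exists Ps : nat -> spolicy,
    (forall i, (i < nP G)%nat -> valid_spolicy (Smax G i) (Lmax G i) (Dmax G i) (Ps i)) /\
    (forall i, (i < nP G)%nat ->
       forall th : policy, valid_policy (Smax G i) (Lmax G i) (Dmax G i) th ->
         Vpay G i (of_stat (Ps i)) Ps >= Vpay G i th Ps).
Proof.
  intros HG.
  destruct (choice (fun j lam => (j < nP G)%nat -> 0 < lam /\
    forall k, (Z.abs k <= Z.of_nat (Smax G j))%Z -> lam <= lawG G j k)) as [lam Hlam].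
  { intros j. destruct (lt_dec j (nP G)) as [Hj|Hj].
    - destruct (HG j Hj) as (_ & Hpos & _ & _).
      destruct (lambda_uniform _ _ Hpos) as [l Hl]. now exists l.
    - exists 0. contradiction. }
  set (sl := fun j => states (Smax G j)).
  set (al := fun j s => filter (admissibleb (Smax G j) s) (actions (Lmax G j) (Dmax G j))).
  set (K := fun j => kernel (Smax G j) (lawG G j)).
  destruct (fixed_point_equilibrium (nP G) sl al K lam (limit_reward G)) as [x Hx].
  - intros j _. discriminate.
  - intros j s _ Hs E. apply in_states in Hs.
    (* The idle action leaves the pre-state at [s] and is therefore always admissible. *)
    assert (Hin : In (0, 0)%nat (al j s)).
    { apply filter_In. split.
      - apply in_prod_iff. rewrite !in_seq. lia.
      - apply admissibleb_spec. unfold admissible, pre_state. simpl. lia. }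
    rewrite E in Hin. contradiction.
  - intros j Hj. now apply Hlam.
  - intros j s a s' Hj _ Ha Hs'. apply filter_In in Ha. destruct Ha as [_ Ha].
    apply admissibleb_spec in Ha. apply in_states in Hs'.
    apply kernel_minor; trivial; [now apply HG|now apply Hlam].
  - intros j s a Hj _ _. apply kernel_total. now apply HG.
  - intros j s a X x Hj. apply limit_reward_cv. now apply HG.
  - intros j Hj. apply limit_reward_bounded. now apply HG.
  - set (Ps := policy_of G x).
    (* Passes between sums over all actions, used by the game, and sums over admissible ones, used
       by the fixed point. *)
    assert (Hal : forall j s (F : action -> R -> R), (forall a, F a 0 = 0) ->
      rsum (fun a => F a (Ps j s a)) (actions (Lmax G j) (Dmax G j)) =
      rsum (fun a => F a (x (VPsi j s a))) (al j s)).
    { intros j s F HF. unfold al. rewrite rsum_filter. apply rsum_ext. intros a _.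
      unfold Ps, policy_of. destruct (admissibleb _ _ _); auto. }
    assert (HPs : forall j, (j < nP G)%nat ->
      valid_spolicy (Smax G j) (Lmax G j) (Dmax G j) (Ps j)).
    { intros j Hj s Hs. destruct (Hx j Hj) as (H0 & H1 & _).
      apply in_states in Hs. split; [|split].
      - intros a Ha. unfold Ps, policy_of. destruct (admissibleb _ _ _) eqn:E; [|lra].
        apply H0; trivial. now apply filter_In.
      - rewrite <- (H1 s Hs). exact (Hal j s (fun _ y => y) (fun _ => eq_refl)).
      - intros a _ Ha. unfold Ps, policy_of. destruct (admissibleb _ _ _) eqn:E; trivial.
        apply admissibleb_spec in E. contradiction. }
    assert (Hcv : forall j s a, (j < nP G)%nat -> (s <= Smax G j)%nat ->
      Un_cv (fun n => margG G j (of_stat (Ps j)) n s a) (x (VPi j s) * policy_of G x j s a)).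
    { intros j s a Hj Hs. destruct (HG j Hj) as (? & ? & ? & ?).
      destruct (Hx j Hj) as (_ & _ & _ & Hpi & Hflow & _).
      apply marg_stat_cv with (lam := lam j) (pi := fun s => x (VPi j s)); auto;
        try now apply Hlam.
      intros s' Hs'. apply in_states in Hs'. rewrite <- Hflow by trivial.
      apply rsum_ext. intros s0 _.
      apply (Hal j s0 (fun a y => x (VPi j s0) * y * K j s0 a s')). intros; ring. }
    exists Ps. split; [exact HPs|]. intros i Hi th Hth.
    destruct (HG i Hi) as (Hlaw & _ & _ & Hinit).
    destruct (Hx i Hi) as (_ & Hsum & _ & _ & _ & Hle & Heq).
    set (h := fun s => x (VH i s)).
    (* What [qval] loses by subtracting [lam i] from each kernel entry is exactly this constant,
       which thereby becomes the average payoff in Bellman's inequality. *)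
    set (g := lam i * rsum h (sl i)).
    assert (Hq : forall s a, qval sl K lam (limit_reward G) x i s a =
      limit_reward G i x s a + rsum (fun s' => K i s a s' * h s') (sl i) - g).
    { intros s a. unfold qval, g. rewrite <- rsum_scal.
      rewrite (rsum_ext _ (fun s' => K i s a s' * h s' - lam i * h s'))
        by (intros; unfold h; ring).
      rewrite rsum_minus. ring. }
    apply Rle_ge, Rle_trans with g.
    + apply (average_stage_bounds G HG Ps HPs x Hcv i Hi th Hth h).
      intros n. apply reward_le_of_bellman; trivial.
      intros s a Hsa Hadm. apply in_pairs in Hsa. destruct Hsa as [Hs Ha].
      apply in_states in Hs. cbn [fst snd].
      assert (Ha' : In a (al i s)) by (apply filter_In; split; trivial; now apply admissibleb_spec).
      specialize (Hle s a Hs Ha'). rewrite Hq in Hle. unfold h at 2. unfold K, sl in Hle. lra.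
    + apply (average_stage_bounds G HG Ps HPs x Hcv i Hi (of_stat (Ps i))
        (of_stat_valid _ _ _ _ (HPs i Hi)) h).
      intros n. apply reward_eq_of_bellman; auto.
      intros s Hs. apply in_states in Hs. cbn [fst snd].
      etransitivity; [apply (Hal i s (fun a y => y * (limit_reward G i x s a +
        rsum (fun s' => K i s a s' * h s') (sl i)))); intros; ring|].
      rewrite (rsum_ext _ (fun a => x (VPsi i s a) * qval sl K lam (limit_reward G) x i s a
        + x (VPsi i s a) * g)) by (intros; rewrite Hq; ring).
      rewrite rsum_plus, rsum_scal_r, Heq, Hsum by trivial. unfold h. ring.
Qed.
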